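(* Let $n\geqslant 3$, let $K$ be a convex body in $\mathbb{R}^n$ and let $u,v\in S^{n-1}$. Let $P_u(K)$ and $P_v(K)$ denote the orthogonal projections of $K$ onto $u^{\perp}$ and $v^{\perp}$, and $P_{u,v}(K)$ the orthogonal projection of $K$ onto $(\mathrm{span}\{u,v\})^{\perp}$. Then $$|P_u(K)|\,|P_v(K)|\geqslant \frac{n}{2(n-1)}\sqrt{1-\langle u,v\rangle^2}\,|K|\,|P_{u,v}(K)|.$$ *)

(* Defs.v *)
From HB Require Import structures.
From mathcomp Require Import all_boot all_order all_algebra.
From mathcomp Require Import all_classical all_reals all_analysis.
Set Implicit Arguments. Unset Strict Implicit. Unset Printing Implicit Defensive.
Import Order.TTheory GRing.Theory Num.Theory.
Import numFieldNormedType.Exports.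
Local Open Scope classical_set_scope.
Local Open Scope ring_scope.

Definition dotv (R : realType) (n : nat) (x y : 'rV[R]_n) : R :=
  \sum_(i < n) x 0 i * y 0 i.

Definition on_sphere (R : realType) (n : nat) (u : 'rV[R]_n) : Prop :=
  dotv u u = 1.

Definition convex_body (R : realType) (n : nat) (K : set 'rV[R]_n) : Prop :=
  [/\ compact K,
      (forall x y (t : R), K x -> K y -> 0 <= t <= 1 -> K (t *: x + (1 - t) *: y))
    & (interior K) !=set0 ].

Definition box (R : realType) (k : nat) (a b : 'rV[R]_k) : set 'rV[R]_k :=
  [set x | forall i, a 0 i <= x 0 i <= b 0 i].

Definition box_vol (R : realType) (k : nat) (a b : 'rV[R]_k) : R :=
  \prod_(i < k) (b 0 i - a 0 i).

Definition lebvol (R : realType) (k : nat) (A : set 'rV[R]_k) : \bar R :=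
  ereal_inf [set s : \bar R | exists (a b : nat -> 'rV[R]_k),
     [/\ (forall j i, a j 0 i <= b j 0 i),
         A `<=` \bigcup_j box (a j) (b j)
       & s = (\sum_(0 <= j <oo) (box_vol (a j) (b j))%:E)%E]].

(* coordinates of (the orthogonal projection of) x with respect to a family
   E of k vectors; for E orthonormal spanning a subspace H, this is an
   isometry from H onto R^k composed with the orthogonal projection onto H *)
Definition coords (R : realType) (n k : nat) (E : 'I_k -> 'rV[R]_n)
  (x : 'rV[R]_n) : 'rV[R]_k := \row_(i < k) dotv x (E i).

Definition orthonormal_family (R : realType) (n k : nat)
  (E : 'I_k -> 'rV[R]_n) : Prop :=
  forall i j, dotv (E i) (E j) = (i == j)%:R.

Definition proj_vol (R : realType) (n k : nat) (E : 'I_k -> 'rV[R]_n)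
  (K : set 'rV[R]_n) : \bar R := lebvol (coords E @` K).

(* Main.v *)
(** Let [L] be the projection of [K] onto [span{u,v}^perp], of dimension [m = n - 2],
    and let [f y], [g y] be the lengths of the fibres over [y \in L] of the
    projections of [K] onto [u^perp] and [v^perp].  The planar fibre of [K] over [y]
    lies in a parallelogram of area [f y * g y / sin], where [sin ^ 2 = 1 - <u,v>^2],
    so by AM-GM the theorem follows from the inequality
      [|L| \int f^2 <= 2 (m + 1) / (m + 2) (\int f)^2]
    for a nonnegative concave function [f] on [L] (a case of Berwald's inequality).
    By the Brunn-Minkowski theorem the volumes of the superlevel sets of [f] have a
    concave [m]-th root, so they cross only once the profile [|L| (1 - t / T)^m] of a
    cone with the same integral, and comparing first moments gives the claim.

    Volumes are handled through [vol], the infimum over finite box covers, which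
    agrees with [lebvol] on compact sets.  It satisfies Fubini's theorem for slices
    of compact sets, and all other properties (comparison of fibre volumes,
    invariance under linear maps of determinant [1] or [-1], Brunn-Minkowski)
    follow from it by induction on the dimension. *)
Require Import Defs.
From mathcomp Require Import all_boot all_order all_algebra.
From mathcomp Require Import all_classical all_reals all_analysis.
From mathcomp Require Import fingroup perm.
From mathcomp Require Import measurable_realfun.
From mathcomp Require Import ring lra.
Set Implicit Arguments. Unset Strict Implicit. Unset Printing Implicit Defensive.
Import Order.TTheory GRing.Theory Num.Theory.
Import numFieldNormedType.Exports.
Local Open Scope classical_set_scope.
Local Open Scope ring_scope.

(** Integrals are taken over the real line only. An integral over [L] is encoded as the volume of a
    compact set with fibres of the right size: [f] is itself a fibre volume, and [\int f^2] is twice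
    the volume of [wedge], whose fibres are right triangles with legs [f y]. Slicing that set by
    height instead of by base point turns the second moment of [f] into the first moment of its
    superlevel volumes, which is what the cone controls. AM-GM has to be weighted: with [a], [b]
    close to the integrals of [f], [g], one uses [2 f g <= (b / a) f^2 + (a / b) g^2], so that both
    terms contribute a multiple of [a * b]; equal weights would give the sum of the squares of the
    integrals. The constant [2 (m + 1) / (m + 2)] is the ratio attained by the cone itself, and for
    [n = m + 2] its inverse is [n / (2 (n - 1))]. Fibre volumes of a compact set are in general only
    upper semicontinuous. This still makes hypographs and superlevel sets compact, so that [vol] can
    be applied to them again. *)

(** * Volume by finite box covers and its behaviour under elementary maps *)

Section FiniteCovers.
Context {R : realType}.

Definition box_cover (k : nat) (A : set 'rV[R]_k) (l : seq ('rV[R]_k * 'rV[R]_k)) :=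
  (forall p, p \in l -> forall i, p.1 0 i <= p.2 0 i) /\
  (forall x, A x -> exists2 p, p \in l & box p.1 p.2 x).

Definition total_vol (k : nat) (l : seq ('rV[R]_k * 'rV[R]_k)) : R :=
  \sum_(p <- l) box_vol p.1 p.2.

(** This is the outer Jordan content. As [inf] of the empty set is 0, a set without finite cover
    gets volume 0; hence the hypothesis [coverable] in [le_vol] and [volU]. In dimension 0 every box
    has volume 1, an empty product. *)
Definition vol (k : nat) (A : set 'rV[R]_k) : R :=
  inf [set total_vol l | l in box_cover A].

Definition coverable (k : nat) (A : set 'rV[R]_k) := box_cover A !=set0.

Definition sec (m p : nat) (K : set 'rV[R]_(m + p)) (y : 'rV[R]_m) : set 'rV[R]_p :=
  [set z | K (row_mx y z)].

Lemma box_vol_ge0 k (a b : 'rV[R]_k) : (forall i, a 0 i <= b 0 i) -> 0 <= box_vol a b.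
Proof. by move=> ab; apply: prodr_ge0 => i _; rewrite subr_ge0. Qed.

Lemma total_vol_ge0 k A (l : seq ('rV[R]_k * 'rV[R]_k)) :
  box_cover A l -> 0 <= total_vol l.
Proof.
by case=> lv _; rewrite /total_vol big_seq; apply: sumr_ge0 => p /lv; exact: box_vol_ge0.
Qed.

Lemma total_vol_lbound k (A : set 'rV[R]_k) :
  has_lbound [set total_vol l | l in box_cover A].
Proof. by exists 0 => _ [l Al <-]; exact: total_vol_ge0 Al. Qed.

Lemma vol_ge0 k (A : set 'rV[R]_k) : 0 <= vol A.
Proof.
rewrite /vol; have [->|/set0P ne] := eqVneq [set total_vol l | l in box_cover A] set0.
  by rewrite inf0.
by apply: lb_le_inf => // _ [l Al <-]; exact: total_vol_ge0 Al.
Qed.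

Lemma vol_le_total k (A : set 'rV[R]_k) l : box_cover A l -> vol A <= total_vol l.
Proof. by move=> Al; apply: ge_inf; [exact: total_vol_lbound|exists l]. Qed.

Lemma vol_ltP k (A : set 'rV[R]_k) c : coverable A -> vol A < c ->
  exists2 l, box_cover A l & total_vol l < c.
Proof.
case=> l0 Al0 /inf_lt[|_ [l Al <-] lc]; last by exists l.
by exists (total_vol l0), l0.
Qed.

Lemma le_vol_cover k (A : set 'rV[R]_k) c : coverable A ->
  (forall l, box_cover A l -> c <= total_vol l) -> c <= vol A.
Proof.
case=> l0 Al0 h; apply: lb_le_inf; first by exists (total_vol l0), l0.
by move=> _ [l Al <-]; exact: h.
Qed.

Lemma box_coverS k (A B : set 'rV[R]_k) l : A `<=` B -> box_cover B l -> box_cover A l.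
Proof. by move=> AB [lv Bl]; split => // x /AB; exact: Bl. Qed.

Lemma coverableS k (A B : set 'rV[R]_k) : A `<=` B -> coverable B -> coverable A.
Proof. by move=> AB [l Bl]; exists l; exact: box_coverS Bl. Qed.

Lemma le_vol k (A B : set 'rV[R]_k) : A `<=` B -> coverable B -> vol A <= vol B.
Proof.
by move=> AB cB; apply: le_vol_cover => // l Bl; apply/vol_le_total/(box_coverS AB).
Qed.

Lemma total_vol_cat k (l l' : seq ('rV[R]_k * 'rV[R]_k)) :
  total_vol (l ++ l') = total_vol l + total_vol l'.
Proof. by rewrite /total_vol big_cat. Qed.

Lemma box_coverU k (A B : set 'rV[R]_k) l l' : box_cover A l -> box_cover B l' ->
  box_cover (A `|` B) (l ++ l').
Proof.
move=> [lv Al] [lv' Bl']; split.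
  by move=> p; rewrite mem_cat => /orP[/lv|/lv'].
move=> x [/Al[p pl px]|/Bl'[p pl px]]; exists p => //; rewrite mem_cat pl ?orbT//.
Qed.

Lemma coverableU k (A B : set 'rV[R]_k) : coverable A -> coverable B ->
  coverable (A `|` B).
Proof. by move=> [l Al] [l' Bl']; exists (l ++ l'); exact: box_coverU. Qed.

Lemma volU k (A B : set 'rV[R]_k) : coverable A -> coverable B ->
  vol (A `|` B) <= vol A + vol B.
Proof.
move=> cA cB; apply/ler_addgt0Pr => e e0.
have [l Al lA] : exists2 l, box_cover A l & total_vol l < vol A + e / 2.
  by apply: vol_ltP; rewrite // ltrDl divr_gt0.
have [l' Bl' lB] : exists2 l, box_cover B l & total_vol l < vol B + e / 2.
  by apply: vol_ltP; rewrite // ltrDl divr_gt0.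
by have := vol_le_total (box_coverU Al Bl'); rewrite total_vol_cat; lra.
Qed.

Lemma box_cover0 k : box_cover (set0 : set 'rV[R]_k) [::].
Proof. by split. Qed.

Lemma vol0 k : vol (set0 : set 'rV[R]_k) = 0.
Proof.
apply/eqP; rewrite eq_le vol_ge0 andbT.
by have := vol_le_total (box_cover0 k); rewrite /total_vol big_nil.
Qed.

Lemma vol_bigcup k (F : nat -> set 'rV[R]_k) N : (forall j, coverable (F j)) ->
  coverable (\bigcup_(j < N) F j) /\
  vol (\bigcup_(j < N) F j) <= \sum_(j < N) vol (F j).
Proof.
move=> cF; elim: N => [|N [cN vN]].
  by rewrite bigcup_mkord !big_ord0 vol0; split => //; exists [::]; exact: box_cover0.
rewrite !bigcup_mkord !big_ord_recr /= -bigcup_mkord; split; first exact: coverableU.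
by apply: le_trans (volU cN (cF N)) _; rewrite lerD2r.
Qed.

(* [r] relates a point of [A] to the points of [B] it accounts for, and [g] is
   the corresponding transformation of boxes; [c] is its volume distortion. *)
Lemma vol_transport k q (A : set 'rV[R]_k) (B : set 'rV[R]_q)
    (r : 'rV[R]_k -> 'rV[R]_q -> Prop)
    (g : 'rV[R]_k * 'rV[R]_k -> 'rV[R]_q * 'rV[R]_q) (c : R) :
  0 <= c ->
  (forall p : 'rV[R]_k * 'rV[R]_k, (forall i, p.1 0 i <= p.2 0 i) -> forall i, (g p).1 0 i <= (g p).2 0 i) ->
  (forall p : 'rV[R]_k * 'rV[R]_k, (forall i, p.1 0 i <= p.2 0 i) ->
     box_vol (g p).1 (g p).2 = c * box_vol p.1 p.2) ->
  (forall (p : 'rV[R]_k * 'rV[R]_k) x z, r x z -> box p.1 p.2 x -> box (g p).1 (g p).2 z) ->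
  (forall z, B z -> exists2 x, A x & r x z) ->
  coverable A -> coverable B /\ vol B <= c * vol A.
Proof.
move=> c0 gv gvol gbox BA cA.
have gcov l : box_cover A l -> box_cover B (map g l).
  case=> lv Al; split=> [_ /mapP[p pl ->]|z /BA[x Ax xz]]; first exact/gv/lv.
  have [p pl px] := Al _ Ax; exists (g p); first exact: map_f.
  exact: gbox xz px.
have gtot l : box_cover A l -> total_vol (map g l) = c * total_vol l.
  case=> lv _; rewrite /total_vol big_map mulr_sumr big_seq [RHS]big_seq.
  by apply: eq_bigr => p /lv; exact: gvol.
split; first by case: cA => l Al; exists (map g l); exact: gcov.
have [c00|cn0] := eqVneq c 0.
  have [l Al] := cA; have := vol_le_total (gcov _ Al).
  by rewrite gtot// c00 !mul0r.
have cp : 0 < c by rewrite lt_def cn0.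
rewrite mulrC -ler_pdivrMr//; apply: le_vol_cover => // l Al.
by rewrite ler_pdivrMr// mulrC -gtot//; exact/vol_le_total/gcov.
Qed.

Lemma vol_translate k (A : set 'rV[R]_k) (v : 'rV[R]_k) : coverable A ->
  vol [set x + v | x in A] <= vol A.
Proof.
move=> cA; rewrite -[leRHS]mul1r.
apply: (proj2 (@vol_transport _ _ A _ (fun x z => z = x + v)
  (fun p => (p.1 + v, p.2 + v)) _ _ _ _ _ _ _)) => //.
- by move=> p pv i; rewrite !mxE lerD2r.
- move=> p pv; rewrite mul1r; apply: eq_bigr => i _; rewrite /= !mxE; ring.
- by move=> p x _ -> px i; rewrite !mxE !lerD2r; exact: px.
- by move=> _ [x Ax <-]; exists x.
Qed.

Lemma vol_diag k (A : set 'rV[R]_k) (d : 'rV[R]_k) : coverable A ->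
  vol [set x *m diag_mx d | x in A] <= `|\prod_i d 0 i| * vol A.
Proof.
move=> cA.
have dE (x : 'rV[R]_k) i : (x *m diag_mx d) 0 i = x 0 i * d 0 i.
  by rewrite mul_mx_diag mxE.
apply: (proj2 (@vol_transport _ _ A _ (fun x z => z = x *m diag_mx d)
  (fun p => (\row_i Num.min (p.1 0 i * d 0 i) (p.2 0 i * d 0 i),
             \row_i Num.max (p.1 0 i * d 0 i) (p.2 0 i * d 0 i))) _ _ _ _ _ _ _)) => //.
- by move=> p pv i; rewrite !mxE ge_min le_max lexx.
- move=> p pv; rewrite normr_prod -big_split; apply: eq_bigr => i _; rewrite /= !mxE.
  rewrite maxEle minEle; have pi := pv i; case: ifP; have [d0|d0] := leP 0 (d 0 i) => h.
  + by rewrite ger0_norm//; ring.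
  (* A negative factor keeps the order of the endpoints only if they coincide, and then both sides
     vanish. *)
  + have : p.1 0 i = p.2 0 i by apply/eqP; rewrite eq_le pi; move: h; rewrite ler_nM2r.
    by move=> ->; ring.
  + by move: h; rewrite ler_wpM2r.
  + by rewrite ltr0_norm//; ring.
- move=> p x _ -> px i; rewrite dE !mxE; have /andP[p1 p2] := px i.
  rewrite ge_min le_max; have [d0|d0] := leP 0 (d 0 i).
    by rewrite (ler_wpM2r d0 p1) (ler_wpM2r d0 p2) orbT.
  by rewrite !(ler_nM2r d0) p1 p2 orbT.
- by move=> _ [x Ax <-]; exists x.
Qed.

Lemma vol_permute k q (A : set 'rV[R]_k) (s : 'I_q -> 'I_k) : bijective s ->
  coverable A -> vol [set \row_i x 0 (s i) | x in A] <= vol A.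
Proof.
move=> bs cA; rewrite -[leRHS]mul1r.
apply: (proj2 (@vol_transport _ _ A _ (fun x z => z = \row_i x 0 (s i))
  (fun p => (\row_i p.1 0 (s i), \row_i p.2 0 (s i))) _ _ _ _ _ _ _)) => //.
- by move=> p pv i; rewrite !mxE.
- move=> p pv; rewrite mul1r /box_vol (reindex s) /=; last exact: onW_bij.
  by apply: eq_bigr => i _; rewrite /= !mxE.
- by move=> p x _ -> px i; rewrite !mxE; exact: px.
- by move=> _ [x Ax <-]; exists x.
Qed.

(** The relation passed to [vol_transport] is not a function: a point of [A] accounts for the whole
    segment over it, and each box is prolonged by the side [[a, b]]. *)
Lemma vol_cylinder k (A : set 'rV[R]_k) (K : set 'rV[R]_(1 + k)) a b : a <= b ->
  (forall x, K x -> a <= x 0 0 <= b /\ A (rsubmx x)) -> coverable A ->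
  coverable K /\ vol K <= (b - a) * vol A.
Proof.
move=> ab KA cA.
apply: (@vol_transport _ _ A K (fun y x => a <= x 0 0 <= b /\ rsubmx x = y)
  (fun p => (row_mx (const_mx a : 'rV_1) p.1, row_mx (const_mx b : 'rV_1) p.2))) => //.
- by rewrite subr_ge0.
- by move=> p pv i; rewrite !mxE; case: (fintype.split i) => j; rewrite ?mxE.
- move=> p pv; rewrite /box_vol big_split_ord /= big_ord1 !row_mxEl !mxE.
  by congr (_ * _); apply: eq_bigr => i _; rewrite !row_mxEr.
- move=> p _ x [x0 <-] px i; rewrite !mxE; case: fintype.splitP => j ij.
    rewrite !mxE (_ : i = 0) //; apply: val_inj; rewrite /= ij; by case: j {ij} => [[]].
  have := px j; rewrite !mxE (_ : rshift 1 j = i)//; exact: val_inj.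
- by move=> x Kx; exists (rsubmx x); have [] := KA _ Kx.
Qed.

End FiniteCovers.

(** * Compactness, thickened covers and semicontinuity of fibre volumes *)

Section Compactness.
Context {R : realType}.

Lemma compact_coord_bounded k (K : set 'rV[R]_k) (i : 'I_k) : compact K ->
  exists2 B : R, 0 < B & forall x, K x -> `|x 0 i| < B.
Proof.
move=> cK; have cKi : compact ((fun x : 'rV[R]_k => x 0 i) @` K).
  by apply: continuous_compact => //; apply/continuous_subspaceT/coord_continuous.
have [M [_ HM]] := @compact_bounded R R^o _ cKi.
exists (`|M| + 2) => [|x Kx]; first by rewrite ltr_wpDl.
apply: (@le_lt_trans _ _ (`|M| + 1)); last by rewrite ltrD2l ltr1n.
by apply: HM; [rewrite ltr_pwDr// ler_norm|exists x].
Qed.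

Lemma compact_coverable k (K : set 'rV[R]_k) : compact K -> coverable K.
Proof.
move=> cK.
have bnd (i : 'I_k) : exists M : R, forall x, K x -> `|x 0 i| <= M.
  by have [B _ HB] := compact_coord_bounded i cK; exists B => x Kx; apply/ltW/HB.
have [M HM] := choice bnd.
exists [:: (- \row_i `|M i|, \row_i `|M i|)]; split.
  by move=> p; rewrite inE => /eqP -> i; rewrite !mxE ge0_cp ?normr_ge0.
move=> x Kx; eexists; first by rewrite inE.
by move=> i; rewrite !mxE -ler_norml (le_trans (HM i _ Kx))// ler_norm.
Qed.

Lemma nbhs_rV_box k (x a b : 'rV[R]_k) : (forall i, a 0 i < x 0 i < b 0 i) ->
  \forall z \near x, box a b z.
Proof.
move=> ax; exists (fun _ i => `[a 0 i, b 0 i]%classic).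
  move=> i j; rewrite ord1; have /andP[a1 b1] := ax j.
  near=> t; rewrite /= in_itv /=; apply/andP; split; apply: ltW; near: t.
    exact: lt_nbhsr.
  exact: lt_nbhsl.
move=> z /= Hz i; have := Hz 0 i; by rewrite /= in_itv.
Unshelve. all: by end_near. Qed.

Lemma box_enlarge k (a b : 'rV[R]_k) e : (forall i, a 0 i <= b 0 i) -> 0 < e ->
  exists a' b' : 'rV[R]_k, [/\ forall i, a' 0 i < a 0 i,
    forall i, b 0 i < b' 0 i & box_vol a' b' < box_vol a b + e].
Proof.
move=> ab e0.
(* The volume of the box thickened by [d] on every side is a polynomial in [d], hence continuous at
   0. *)
pose p : {poly R} := \prod_(i < k) ((b 0 i - a 0 i)%:P + 'X *+ 2).
have pE d : p.[d] = box_vol (\row_i (a 0 i - d)) (\row_i (b 0 i + d)).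
  rewrite /p horner_prod; apply: eq_bigr => i _.
  by rewrite hornerD hornerC hornerMn hornerX !mxE mulr2n; ring.
have p0 : p.[0] = box_vol a b.
  by rewrite pE; apply: eq_bigr => i _; rewrite !mxE addr0 subr0.
have : \forall d \near (0 : R), p.[d] < box_vol a b + e.
  have := @continuous_horner R p 0; rewrite /continuous_at p0 => /cvgr_lt; apply.
  by rewrite ltrDl.
move/nbhs_ballP => [d /= d0 hd].
exists (\row_i (a 0 i - d / 2)), (\row_i (b 0 i + d / 2)); split.
- by move=> i; rewrite mxE gtrBl divr_gt0.
- by move=> i; rewrite mxE ltrDl divr_gt0.
- rewrite -pE; apply: hd; rewrite /ball /= sub0r normrN gtr0_norm; lra.
Qed.

(** [box_cover set0 l] merely records that the boxes of [l] have ordered endpoints. The gain is that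
    points covered by [l] become interior to the union of [l']. *)
Lemma cover_enlarge k (l : seq ('rV[R]_k * 'rV[R]_k)) e :
  box_cover set0 l -> 0 < e -> exists l', [/\ box_cover set0 l',
    total_vol l' < total_vol l + e &
    forall p x, p \in l -> box p.1 p.2 x ->
      \forall z \near x, exists2 q, q \in l' & box q.1 q.2 z].
Proof.
elim: l e => [|p l IH] e [lv _] e0.
  by exists [::]; split; [exact: box_cover0|rewrite ltrDl|].
have [||l' [[lv' _] tl' nl']] := IH (e / 2); [|by rewrite divr_gt0|].
  by split => // q ql; apply: lv; rewrite inE ql orbT.
have pv : forall i, p.1 0 i <= p.2 0 i by apply: lv; rewrite mem_head.
have [|a [b [ap pb vab]]] := box_enlarge pv (_ : 0 < e / 2); first by rewrite divr_gt0.
exists ((a, b) :: l'); split.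
- split => // q; rewrite inE => /predU1P[->/= i|]; last exact: lv'.
  by apply: ltW; apply: lt_le_trans (ap i) _; apply: le_trans (pv i) (ltW (pb i)).
- by rewrite /total_vol !big_cons /= -!/(total_vol _); lra.
- move=> q x; rewrite inE => /predU1P[->|ql] qx.
    have abx i : a 0 i < x 0 i < b 0 i.
      have /andP[h1 h2] := qx i; apply/andP; split.
        exact: lt_le_trans (ap i) h1.
      exact: le_lt_trans h2 (pb i).
    have := nbhs_rV_box abx; apply: filterS => z abz; exists (a, b) => //.
    exact: mem_head.
  have := nl' _ _ ql qx; apply: filterS => z [r rl rz]; exists r => //.
  by rewrite inE rl orbT.
Qed.

Lemma rV_hausdorff k : hausdorff_space 'rV[R]_k.
Proof. exact: norm_hausdorff. Qed.

Lemma rV_continuous (T : topologicalType) k (f : T -> 'rV[R]_k) :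
  (forall i, continuous (fun t => f t 0 i)) -> continuous f.
Proof.
move=> cf t A [P Pf sPA]; rewrite /nbhs/=.
have : \forall s \near t, forall i, P 0 i (f s 0 i).
  apply: filter_forall => i; apply: cf; exact: Pf.
by apply: filterS => s Ps; apply: sPA => i j; rewrite ord1.
Qed.

Lemma compact_image (k q : nat) (K : set 'rV[R]_k) (f : 'rV[R]_k -> 'rV[R]_q) :
  continuous f -> compact K -> compact (f @` K).
Proof. by move=> cf; apply: continuous_compact; exact: continuous_subspaceT. Qed.

Lemma row_mx_continuous m p (y : 'rV[R]_m) : continuous (fun z : 'rV[R]_p => row_mx y z).
Proof.
apply: rV_continuous => i z; case: (split_ordP i) => j ->.
  by under eq_fun do rewrite row_mxEl; exact: cst_continuous.
by under eq_fun do rewrite row_mxEr; exact: coord_continuous.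
Qed.

Lemma compact_sec m p (K : set 'rV[R]_(m + p)) (y : 'rV[R]_m) :
  compact K -> compact (sec K y).
Proof.
move=> cK; apply: (@subclosed_compact _ _ (rsubmx @` K)).
- have clK : closed K by apply: compact_closed => //; exact: rV_hausdorff.
  by apply: preimage_closed; [|exact: clK] => z _; exact: row_mx_continuous.
- by apply: compact_image => //; exact: continuous_rsubmx.
- by move=> z Kz; exists (row_mx y z) => //; rewrite row_mxKr.
Qed.

(* The tube lemma: a box cover of one fibre, once thickened, covers the
   neighbouring fibres, so that the volume of fibres is upper semicontinuous. *)
Lemma sec_near m p (K : set 'rV[R]_(m + p)) (y : 'rV[R]_m) c : compact K ->
  vol (sec K y) < c ->
  exists l : seq ('rV[R]_p * 'rV[R]_p), [/\ box_cover set0 l, total_vol l < c &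
    \forall y' \near y, box_cover (sec K y') l].
Proof.
move=> cK vc; have cy := compact_coverable (compact_sec (y := y) cK).
have [l0 [lv0 Kl0] tl0] := vol_ltP cy vc.
have [||l [cl tl nl]] := @cover_enlarge _ l0 (c - total_vol l0).
- by split.
- by rewrite subr_gt0.
exists l; split => //; first by lra.
pose U := [set z | exists2 q, q \in l & box q.1 q.2 z].
(* [C] is the part of [K] whose last coordinates escape the interior of the thickened cover. Its
   projection is compact, hence closed, and misses [y], so it misses a neighbourhood of [y]. *)
pose C := K `&` rsubmx @^-1` (~` (interior U)).
have cC : compact C.
  apply: compact_closedI => //; apply: preimage_closed.
    by move=> z _; exact: continuous_rsubmx.
  by apply: open_closedC; exact: open_interior.
have clC : closed (lsubmx @` C).
  apply: compact_closed; first exact: rV_hausdorff.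
  by apply: compact_image => //; exact: continuous_lsubmx.
have : nbhs y (~` (lsubmx @` C)).
  apply: open_nbhs_nbhs; split; first exact: closed_openC.
  case=> x [Kx Ux] xy; apply: Ux => /=; rewrite /interior /=.
  have [q ql qx] : exists2 q, q \in l0 & box q.1 q.2 (rsubmx x).
    by apply: Kl0; rewrite /sec /= -xy hsubmxK.
  exact: nl qx.
apply: filterS => y' Hy'; split; first by case: cl.
move=> z Kz; apply: contrapT => nz; apply: Hy'; exists (row_mx y' z).
  by split => //=; rewrite row_mxKr => /interior_subset.
by rewrite row_mxKl.
Qed.

Lemma closed_vol_sec m p (K : set 'rV[R]_(m + p)) (c : R) : compact K ->
  closed [set y : 'rV[R]_m | c <= vol (sec K y)].
Proof.
move=> cK; rewrite -[X in closed X]setCK; apply: open_closedC.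
rewrite openE => y /= /negP; rewrite -ltNge => /(sec_near cK)[l [_ tl ny]].
move: ny; apply: filterS => y' h /=; apply/negP; rewrite -ltNge.
exact: le_lt_trans (vol_le_total h) tl.
Qed.

End Compactness.

(** * Agreement with Lebesgue outer measure on compact sets *)

Section LebvolCompact.
Context {R : realType}.

(** A finite cover is padded to a sequence by copies of the box from 0 to 0. Its volume is 0 only in
    positive dimension, hence [k.+1]. *)
Lemma lebvol_le_total k (K : set 'rV[R]_k.+1) l : box_cover K l ->
  (lebvol K <= (total_vol l)%:E)%E.
Proof.
move=> [lv Kl]; pose F j := nth (0 : 'rV[R]_k.+1, 0 : 'rV[R]_k.+1) l j.
have Fv j i : (F j).1 0 i <= (F j).2 0 i.
  have [jl|lj] := ltnP j (size l); first by apply: lv; exact: mem_nth.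
  by rewrite /F nth_default.
apply: ereal_inf_lbound; exists (fun j => (F j).1), (fun j => (F j).2); split => //.
  move=> x /Kl[p pl px]; exists (index p l) => //=.
  by rewrite /F nth_index.
rewrite (nneseries_split 0 (size l))//; last by move=> j _; rewrite lee_fin; exact: box_vol_ge0.
rewrite eseries0 ?adde0; last first.
  move=> j lj _; rewrite /F nth_default ?(leq_trans _ lj)//= /box_vol.
  by rewrite big_ord_recl /= subrr mul0r.
by rewrite add0n sumEFin /total_vol (big_nth (0, 0)).
Qed.

(** The [j]-th box is enlarged at a cost below [e / 2 ^ (j + 1)]; the interiors of the enlarged
    boxes still cover [K], and by compactness finitely many of them do. *)
Lemma total_le_lebvol_eps k (K : set 'rV[R]_k) (a b : nat -> 'rV[R]_k) (e : R) :
  compact K -> (forall j i, a j 0 i <= b j 0 i) -> K `<=` \bigcup_j box (a j) (b j) ->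
  0 < e ->
  ((vol K)%:E <= \sum_(0 <= j <oo) (box_vol (a j) (b j))%:E + e%:E)%E.
Proof.
move=> cK ab Kab e0.
have ej j : 0 < e / (2 ^ j.+1)%:R by rewrite divr_gt0// ltr0n expn_gt0.
have /choice[f Hf] j : exists c : 'rV[R]_k * 'rV[R]_k,
    [/\ forall i, c.1 0 i < a j 0 i, forall i, b j 0 i < c.2 0 i &
     box_vol c.1 c.2 < box_vol (a j) (b j) + e / (2 ^ j.+1)%:R].
  by have [a' [b' H]] := box_enlarge (ab j) (ej j); exists (a', b').
have fv j i : (f j).1 0 i <= (f j).2 0 i.
  have [h1 h2 _] := Hf j; apply/ltW/(lt_trans (h1 i))/(le_lt_trans (ab j i))/h2.
have := cK; rewrite compact_cover => /(_ nat setT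
  (fun j => interior (box (f j).1 (f j).2))) [].
- by move=> j _; exact: open_interior.
- move=> x /Kab[j _ xj]; exists j => //; apply: nbhs_rV_box => i.
  have [h1 h2 _] := Hf j; have /andP[x1 x2] := xj i.
  by rewrite (lt_le_trans (h1 i) x1) (le_lt_trans x2 (h2 i)).
move=> D _ KD; pose N := (\max_(j <- finmap.enum_fset D) j).+1.
have cov : box_cover K (map f (iota 0 N)).
  split=> [_ /mapP[j _ ->]|x /KD[j /= jD /interior_subset xj]]; first exact: fv.
  exists (f j); last exact: xj.
  have : j \in iota 0 N.
    rewrite mem_iota /= add0n ltnS; exact: (@leq_bigmax_seq _ _ xpredT id).
  exact: map_f.
apply: le_trans (epsilon_trick xpredT _ (ltW e0)); last first.
  by move=> j; rewrite lee_fin; exact: box_vol_ge0.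
apply: (@le_trans _ _ (\sum_(0 <= j < N) (box_vol (a j) (b j) + e / (2 ^ j.+1)%:R)%:E)%E).
  rewrite sumEFin lee_fin; apply: le_trans (vol_le_total cov) _.
  rewrite /total_vol big_map -/(index_iota 0 N) ler_sum// => j _.
  by apply: ltW; have [] := Hf j.
apply: nneseries_lim_ge => j _ _.
by rewrite lee_fin addr_ge0 ?box_vol_ge0// ltW.
Qed.

Lemma lebvol_compact k (K : set 'rV[R]_k.+1) : compact K -> lebvol K = (vol K)%:E.
Proof.
move=> cK; have cov := compact_coverable cK; apply/eqP; rewrite eq_le; apply/andP; split.
  apply/lee_addgt0Pr => e e0.
  have [l Kl tl] : exists2 l, box_cover K l & total_vol l < vol K + e.
    by apply: vol_ltP; rewrite // ltrDl.
  by apply: le_trans (lebvol_le_total Kl) _; rewrite -EFinD lee_fin ltW.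
apply: le_ereal_inf_tmp => _ [a [b [ab Kab ->]]]; apply/lee_addgt0Pr => e e0.
exact: total_le_lebvol_eps.
Qed.

End LebvolCompact.

(** * Fubini for compact sets: upper bound for the integral of section volumes *)

Section Fubini.
Context {R : realType}.
Notation mu := (@lebesgue_measure R).

Definition cst1 (s : R) : 'rV[R]_1 := const_mx s.

Lemma cst1_continuous : continuous cst1.
Proof.
apply: rV_continuous => i s; under eq_fun do rewrite mxE; exact: cvg_id.
Qed.

Lemma cst1_row_mxE k s (y : 'rV[R]_k) : (row_mx (cst1 s) y) 0 0 = s.
Proof. by rewrite mxE; case: fintype.splitP => j //= _; rewrite mxE. Qed.

Lemma row_mx_cst1 k (x : 'rV[R]_(1 + k)) : row_mx (cst1 (x 0 0)) (rsubmx x) = x.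
Proof.
rewrite -[RHS]hsubmxK; congr row_mx; apply/rowP => i; rewrite !mxE ord1.
by congr (x _ _); exact: val_inj.
Qed.

(** By [sec_near] the section volume is upper semicontinuous, so its opposite is lower
    semicontinuous, hence measurable. *)
Lemma measurable_vol_sec k (K : set 'rV[R]_(1 + k)) : compact K ->
  measurable_fun setT (fun s => vol (sec K (cst1 s))).
Proof.
move=> cK; apply/measurable_EFinP.
suff mN : measurable_fun setT (fun s => (- vol (sec K (cst1 s)))%:E).
  rewrite (_ : EFin \o _ = (fun x => - x)%E \o
      (fun s => (- vol (sec K (cst1 s)))%:E)); last first.
    by apply/funext => s; rewrite /= opprK.
  by apply: measurableT_comp => //; exact: oppe_measurable.
apply: lower_semicontinuous_measurable => s a; rewrite lte_fin ltrNr.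
move=> /(sec_near cK)[l [_ tl nl]].
exists (cst1 @^-1` [set y | box_cover (sec K y) l]); first exact: cst1_continuous.
move=> s' /= h; rewrite lte_fin ltrNr.
exact: le_lt_trans (vol_le_total h) tl.
Qed.

(** It suffices to compare with each cover [l]: the section at [s] is covered by the boxes whose
    first side contains [s], and integrating their lower-dimensional volumes over [s] gives
    [total_vol l]. *)
Lemma integral_vol_sec_le k (K : set 'rV[R]_(1 + k)) : compact K ->
  (\int[mu]_s (vol (sec K (cst1 s)))%:E <= (vol K)%:E)%E.
Proof.
move=> cK; suff H l : box_cover K l ->
    (\int[mu]_s (vol (sec K (cst1 s)))%:E <= (total_vol l)%:E)%E.
  apply/lee_addgt0Pr => e e0.
  have [l Kl tl] : exists2 l, box_cover K l & total_vol l < vol K + e.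
    by apply: vol_ltP; rewrite ?ltrDl//; exact: compact_coverable.
  by apply: le_trans (H _ Kl) _; rewrite -EFinD lee_fin ltW.
move=> [lv Kl].
(* The absolute value makes [G p] nonnegative also for pairs whose endpoints are not ordered. *)
pose w (p : 'rV[R]_(1 + k) * 'rV[R]_(1 + k)) := `|box_vol (rsubmx p.1) (rsubmx p.2)|.
pose I (p : 'rV[R]_(1 + k) * 'rV[R]_(1 + k)) := `[p.1 0 0, p.2 0 0]%classic : set R.
pose G p s := ((w p)%:E * (\1_(I p) s)%:E)%E.
have mG p : measurable_fun setT (G p).
  apply: measurable_funeM; apply/measurable_EFinP; apply: measurable_indic; exact: measurable_itv.
have G0 p s : (0 <= G p s)%E by rewrite /G -EFinM lee_fin mulr_ge0// /w normr_ge0.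
pose T := ('rV[R]_(1 + k) * 'rV[R]_(1 + k))%type.
pose S s := \big[+%E/0%E]_(p <- l) (G : T -> R -> \bar R) p s.
apply: (@le_trans _ _ (\int[mu]_s S s)%E).
  apply: ge0_le_integral => //.
  - by move=> s _; rewrite lee_fin vol_ge0.
  - by apply/measurable_EFinP; exact: measurable_vol_sec.
  - exact: emeasurable_sum.
  move=> s _; rewrite /S; under eq_bigr do rewrite /G -EFinM.
  rewrite sumEFin lee_fin.
  pose l' := [seq (rsubmx p.1, rsubmx p.2) | p : T <- l & p.1 0 0 <= s <= p.2 0 0].
  have cl' : box_cover (sec K (cst1 s)) l'.
    split=> [q /mapP[p]|z /Kl[p pl pz]].
      by rewrite mem_filter => /andP[_ pl] -> i; rewrite !mxE; exact: lv.
    exists (rsubmx p.1, rsubmx p.2).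
      by apply: map_f; rewrite mem_filter pl andbT; have := pz 0; rewrite cst1_row_mxE.
    by move=> i; have := pz (rshift 1 i); rewrite row_mxEr !mxE.
  apply: le_trans (vol_le_total cl') _.
  rewrite /total_vol big_map big_filter big_mkcond /=; apply: ler_sum => p _.
  rewrite indicE /I; case: ifPn => h.
    by rewrite mem_set /= ?in_itv//= mulr1 ler_norm.
  by rewrite mulr_ge0// /w normr_ge0.
rewrite ge0_integral_sum// /total_vol -sumEFin big_seq [leRHS]big_seq.
apply: lee_sum => p pl.
have mI : measurable (I p) by exact: measurable_itv.
have -> : (\int[mu]_s G p s = (w p)%:E * mu (I p))%E.
  rewrite -[X in (_ * mu X)%E]setIT -integral_indic// -ge0_integralZl//.
  - by apply/measurable_EFinP; exact: measurable_indic.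
  - by rewrite lee_fin /w normr_ge0.
rewrite lebesgue_measure_itv /= lte_fin.
have p00 := lv _ pl 0.
have -> : box_vol p.1 p.2 = w p * (p.2 0 0 - p.1 0 0).
  rewrite /w ger0_norm; last by apply: box_vol_ge0 => i; rewrite !mxE; exact: lv.
  rewrite mulrC /box_vol big_split_ord big_ord1 /= (_ : lshift k 0 = 0); last exact: val_inj.
  by congr (_ * _); apply: eq_bigr => i _; rewrite !mxE.
case: ltP => h; first by rewrite -EFinD -EFinM.
by rewrite mule0 lee_fin; apply: mulr_ge0; rewrite ?subr_ge0// /w normr_ge0.
Qed.

End Fubini.

(** * Fubini for compact sets: the reverse inequality *)

Section FubiniEq.
Context {R : realType}.
Notation mu := (@lebesgue_measure R).

(* Slicing [K] along a grid of mesh [h N] bounds [vol K] by the integral of the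
   step function [g N]; by the tube lemma [g N] tends to the section volume. *)
Lemma integral_vol_sec_ge k (K : set 'rV[R]_(1 + k)) : compact K ->
  ((vol K)%:E <= \int[mu]_s (vol (sec K (cst1 s)))%:E)%E.
Proof.
move=> cK; have [B B0 HB] := compact_coord_bounded (0 : 'I_(1 + k)) cK.
pose A := rsubmx @` K.
have cA : coverable A.
  by apply/compact_coverable/compact_image => //; exact: continuous_rsubmx.
pose h (N : nat) := 2 * B / N.+1%:R.
have h0 N : 0 < h N by rewrite divr_gt0// mulr_gt0.
have hN N : N.+1%:R * h N = 2 * B by rewrite /h mulrC divfK// pnatr_eq0.
(* Half-open cells are disjoint, and the first [N + 1] of them exhaust [[-B, B[]; this is enough
   because the bound [HB] is strict. *)
pose cell N j : set R := `[- B + j%:R * h N, - B + j.+1%:R * h N[%classic.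
have cellE N j s : cell N j s = (j%:R <= (s + B) / h N < j.+1%:R) :> Prop.
  rewrite /cell /= in_itv /= ler_pdivlMr// ltr_pdivrMr//.
  by rewrite addrC lerBlDr [- B + _]addrC ltrBrDr.
pose P N j := [set y | exists2 s, cell N j s & K (row_mx (cst1 s) y)].
have PA N j : P N j `<=` A.
  by move=> y [s _ Ksy]; exists (row_mx (cst1 s) y) => //; rewrite row_mxKr.
have cP N j : coverable (P N j) by apply: coverableS cA; exact: PA.
pose v N j := vol (P N j).
pose g N s := \sum_(j < N.+1) v N j * \1_(cell N j) s.
have mcell N j : measurable (cell N j) by exact: measurable_itv.
have mcst N j c : measurable_fun setT (fun s => c * \1_(cell N j) s : R).
  by apply: measurable_funM; [exact: measurable_cst|apply: measurable_indic].
have mg N : measurable_fun setT (g N) by apply: measurable_sum => j; exact: mcst.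
have gin N s : - B <= s < B -> exists2 j, cell N j s & g N s = v N j.
  move=> /andP[s1 s2].
  have t0 : 0 <= (s + B) / h N by rewrite divr_ge0 ?(ltW (h0 N))//; lra.
  have tN : (s + B) / h N < N.+1%:R.
    rewrite ltr_pdivrMr// hN; lra.
  have /andP[j1 j2] := truncn_itv t0; set j := Num.truncn _ in j1 j2.
  have jN : (j < N.+1)%N by rewrite -(ltr_nat R); exact: le_lt_trans j1 tN.
  exists j; first by rewrite cellE j1.
  rewrite /g (bigD1 (Ordinal jN)) //= indicE mem_set ?cellE ?j1// mulr1.
  rewrite big1 ?addr0// => i ij; rewrite indicE memNset ?mulr0//.
  rewrite cellE => /truncn_def ji; move/eqP: ij; apply; apply: val_inj => /=.
  by rewrite -ji.
have gout N s : ~~ (- B <= s < B) -> g N s = 0.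
  move=> sB; rewrite /g big1 // => j _; rewrite indicE memNset ?mulr0//.
  rewrite cellE => /andP[j1 j2]; move/negP: sB; apply.
  have : 0 <= (s + B) / h N by apply: le_trans j1.
  rewrite pmulr_lge0 ?invr_gt0// => t0; apply/andP; split; first lra.
  have : (s + B) / h N < N.+1%:R by apply: lt_le_trans j2 _; rewrite ler_nat.
  rewrite ltr_pdivrMr// hN; lra.
have g0 N s : 0 <= g N s.
  by apply: sumr_ge0 => j _; rewrite mulr_ge0// /v vol_ge0.
have int_g N : (\int[mu]_s (g N s)%:E = (\sum_(j < N.+1) h N * v N j)%:E)%E.
  rewrite /g; under eq_integral do rewrite -sumEFin.
  rewrite ge0_integral_sum//; last 2 first.
  - move=> j; apply/measurable_EFinP; exact: mcst.
  - by move=> j s _; rewrite lee_fin mulr_ge0// /v vol_ge0.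
  rewrite -sumEFin; apply: eq_bigr => j _; under eq_integral do rewrite EFinM.
  rewrite ge0_integralZl//; last 2 first.
  - by apply/measurable_EFinP; apply: measurable_indic; exact: mcell.
  - by rewrite lee_fin /v vol_ge0.
  have -> : (\int[mu]_s (\1_(cell N j) s)%:E = mu (cell N j))%E.
    by rewrite -[X in mu X]setIT -integral_indic//; exact: mcell.
  rewrite lebesgue_measure_itv /= lte_fin ifT.
    by rewrite -EFinD -EFinM -natr1; congr EFin; ring.
  by rewrite ltrD2l ltr_pM2r// ltr_nat.
have Kg N : ((vol K)%:E <= \int[mu]_s (g N s)%:E)%E.
  rewrite int_g lee_fin.
  pose F j := [set x : 'rV[R]_(1 + k) | K x /\ cell N j (x 0 0)].
  have F_h j : coverable (F j) /\ vol (F j) <= h N * v N j.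
    have := @vol_cylinder _ _ (P N j) (F j) (- B + j%:R * h N) (- B + j.+1%:R * h N).
    have -> : - B + j.+1%:R * h N - (- B + j%:R * h N) = h N by rewrite -natr1; ring.
    apply => //; first by rewrite lerD2l ler_pM2r// ler_nat.
    move=> x [Kx xj]; split; last by exists (x 0 0); rewrite ?row_mx_cst1.
    by move: xj; rewrite /cell /= in_itv /= => /andP[-> /ltW ->].
  have [cU vU] := @vol_bigcup _ _ F N.+1 (fun j => (F_h j).1).
  apply: (@le_trans _ _ (vol (\bigcup_(j < N.+1) F j))).
    apply: le_vol => // x Kx.
    have xB : - B <= x 0 0 < B.
      by have := HB _ Kx; rewrite ltr_norml => /andP[/ltW -> ->].
    have [j xj _] := gin N _ xB; exists j => //=.
    rewrite -(ltr_nat R); move: xj; rewrite cellE => /andP[xj _].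
    apply: le_lt_trans xj _; move: xB => /andP[xB1 xB2].
    rewrite ltr_pdivrMr// hN; lra.
  by apply: le_trans vU _; apply: ler_sum => j _; have [] := F_h j.
have mF := measurable_vol_sec cK.
have secA s : sec K (cst1 s) `<=` A.
  by move=> z Kz; exists (row_mx (cst1 s) z) => //; rewrite row_mxKr.
have [] := @dominated_convergence _ _ R mu setT measurableT
  (fun N s => (g N s)%:E) (fun s => (vol (sec K (cst1 s)))%:E)
  (fun s => ((vol A)%:E * (\1_(`[- B, B[%classic) s)%:E)%E).
- by move=> N; apply/measurable_EFinP; exact: mg.
- apply/measurable_EFinP; exact: mF.
- apply: aeW => s _; apply: cvg_EFin; first by near=> N.
  have [sB|sB] := boolP (- B <= s < B); last first.
    rewrite (_ : sec _ _ = set0) ?vol0; last first.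
      apply/seteqP; split => // z /HB; rewrite cst1_row_mxE ltr_norml.
      by move=> /andP[/ltW h1 h2]; move: sB; rewrite h1 h2.
    rewrite [X in X @ _ --> _](_ : _ = cst 0); first exact: cvg_cst.
    by apply/funext => N /=; exact: gout.
  apply/cvgrPdist_le => e e0.
  (* One cover [l] of nearly optimal volume serves all sections at distance less than [d] from [s].
     Once the mesh is below [d], it covers the whole of [P N j]. *)
  have [||l [_ tl]] := @sec_near _ _ _ K (cst1 s) (vol (sec K (cst1 s)) + e) => //.
    by rewrite ltrDl.
  move=> /cst1_continuous /nbhs_ballP[d /= d0 hd].
  have hd0 : \forall N \near \oo, h N < d.
    have e1 : 0 < d / (2 * B) by rewrite divr_gt0// mulr_gt0.
    have := near_infty_natSinv_lt (PosNum e1); apply: filterS => N /=.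
    by rewrite ltr_pdivlMr ?mulr_gt0// mulrC.
  near=> N; rewrite /=.
  have [j sj ->] := gin N _ sB.
  have le1 : vol (sec K (cst1 s)) <= v N j.
    by apply: le_vol => // z Kz; exists s.
  rewrite distrC ger0_norm ?subr_ge0// lerBlDl; apply: ltW; apply: le_lt_trans tl.
  rewrite /v; have clP : box_cover (P N j) l.
    split; first by case: (hd s (ballxx _ d0)).
    move=> z [s' s'j Kz].
    have : ball s d s'.
      rewrite /ball /=; move: sj s'j; rewrite /cell /= !in_itv /= -natr1 mulrDl mul1r.
      have hd' : h N < d by near: N.
      by move=> /andP[? ?] /andP[? ?]; rewrite ltr_norml; apply/andP; split; lra.
    by move=> /hd [_]; exact.
  exact: vol_le_total clP.
- apply: integrableZl => //; exact: integrable_indic_itv.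
- apply: aeW => s N _; rewrite (_ : `|(g N s)%:E|%E = (g N s)%:E); last by rewrite gee0_abs// lee_fin.
  rewrite lee_fin indicE.
  have [sB|sB] := boolP (- B <= s < B); last by rewrite gout// mulr_ge0// vol_ge0.
  rewrite mem_set /= ?in_itv//= mulr1; have [j _ ->] := gin N _ sB.
  exact: le_vol.
by move=> _ _ cvgI; apply: (cvge_ge _ cvgI); exact: nearW.
Unshelve. all: by end_near. Qed.

Lemma vol_fubini k (K : set 'rV[R]_(1 + k)) : compact K ->
  (vol K)%:E = (\int[mu]_s (vol (sec K (cst1 s)))%:E)%E.
Proof.
move=> cK; apply/eqP; rewrite eq_le integral_vol_sec_ge//=.
exact: integral_vol_sec_le.
Qed.

End FubiniEq.

(** * Comparison of fibre volumes and invariance under linear maps *)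

Section LinearInvariance.
Context {R : realType}.
Notation mu := (@lebesgue_measure R).

Lemma measurable_EFin_vol_sec k (K : set 'rV[R]_(1 + k)) : compact K ->
  measurable_fun setT (fun s => (vol (sec K (cst1 s)))%:E).
Proof. by move=> cK; apply/measurable_EFinP; exact: measurable_vol_sec. Qed.

(** Two summands, in possibly different dimensions, are carried because Brunn-Minkowski and AM-GM
    both relate one volume to a combination of two others. A comparison of two volumes is the case
    [b = 0]. *)
Lemma vol_fubini_lin p q (B : set 'rV[R]_(1 + p)) (C : set 'rV[R]_(1 + q)) (a b : R) :
  compact B -> compact C -> 0 <= a -> 0 <= b ->
  measurable_fun setT
    (fun s => (a * vol (sec B (cst1 s)) + b * vol (sec C (cst1 s)))%:E) /\
  (a * vol B + b * vol C)%:E =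
  (\int[mu]_s (a * vol (sec B (cst1 s)) + b * vol (sec C (cst1 s)))%:E)%E.
Proof.
move=> cB cC a0 b0.
have mB := measurable_EFin_vol_sec cB; have mC := measurable_EFin_vol_sec cC.
have v0 k' (K : set 'rV[R]_(1 + k')) s : (0 <= (vol (sec K (cst1 s)))%:E)%E.
  by rewrite lee_fin vol_ge0.
under [X in measurable_fun _ X]eq_fun do rewrite EFinD !EFinM.
under eq_integral do rewrite EFinD !EFinM.
split; first by apply: emeasurable_funD; exact: measurable_funeM.
rewrite EFinD !EFinM !vol_fubini// -!ge0_integralZl ?lee_fin// -ge0_integralD//.
- by move=> s _; rewrite mule_ge0.
- exact: measurable_funeM.
- by move=> s _; rewrite mule_ge0.
- exact: measurable_funeM.
Qed.

Lemma vol_fubini_le k p q (A : set 'rV[R]_(1 + k)) (B : set 'rV[R]_(1 + p))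
    (C : set 'rV[R]_(1 + q)) (a b : R) :
  compact A -> compact B -> compact C -> 0 <= a -> 0 <= b ->
  (forall s, vol (sec A (cst1 s)) <= a * vol (sec B (cst1 s)) + b * vol (sec C (cst1 s))) ->
  vol A <= a * vol B + b * vol C.
Proof.
move=> cA cB cC a0 b0 h; have [m vBC] := vol_fubini_lin cB cC a0 b0.
rewrite -lee_fin vBC vol_fubini//; apply: ge0_le_integral => //.
- by move=> s _; rewrite lee_fin vol_ge0.
- exact: measurable_EFin_vol_sec.
- by move=> s _; rewrite lee_fin.
Qed.

Lemma vol_fubini_ge k p q (A : set 'rV[R]_(1 + k)) (B : set 'rV[R]_(1 + p))
    (C : set 'rV[R]_(1 + q)) (a b : R) :
  compact A -> compact B -> compact C -> 0 <= a -> 0 <= b ->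
  (forall s, a * vol (sec B (cst1 s)) + b * vol (sec C (cst1 s)) <= vol (sec A (cst1 s))) ->
  a * vol B + b * vol C <= vol A.
Proof.
move=> cA cB cC a0 b0 h; have [m vBC] := vol_fubini_lin cB cC a0 b0.
rewrite -lee_fin vBC vol_fubini//; apply: ge0_le_integral => //.
- by move=> s _; rewrite lee_fin addr_ge0// mulr_ge0// vol_ge0.
- exact: measurable_EFin_vol_sec.
- by move=> s _; rewrite lee_fin.
Qed.

Lemma row_mx1A m p s (y : 'rV[R]_m) (z : 'rV[R]_p) :
  row_mx (cst1 s) (row_mx y z) = row_mx (row_mx (cst1 s) y) z :> 'rV[R]_(m.+1 + p).
Proof. by rewrite row_mxA; apply: castmx_id. Qed.

Lemma sec0 p (K : set 'rV[R]_(0 + p)) y : sec K y = K.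
Proof. by apply/funext => z; rewrite /sec /= row_thin_mx. Qed.

(** One base coordinate is sliced off at a time, so that a comparison of fibres over an
    [m]-dimensional base needs no integral over that base. *)
Lemma vol_sec_le m k p q (A : set 'rV[R]_(m + k)) (B : set 'rV[R]_(m + p))
    (C : set 'rV[R]_(m + q)) (a b : R) :
  compact A -> compact B -> compact C -> 0 <= a -> 0 <= b ->
  (forall y, vol (sec A y) <= a * vol (sec B y) + b * vol (sec C y)) ->
  vol A <= a * vol B + b * vol C.
Proof.
move=> + + + a0 b0; elim: m A B C => [|m IH] A B C cA cB cC h.
  by have := h 0; rewrite !sec0.
apply: (@vol_fubini_le (m + k) (m + p) (m + q)) => // s.
apply: IH; [exact: (@compact_sec _ 1 (m + _))..|] => y.
have secE r (K : set 'rV[R]_(m.+1 + r)) :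
    sec (@sec R 1 (m + r) K (cst1 s)) y = sec K (row_mx (cst1 s) y).
  by apply/funext => z; rewrite /sec /= row_mx1A.
by rewrite !secE; exact: h.
Qed.

Lemma mulmx_continuous k q (U : 'M[R]_(k, q)) : continuous (fun x : 'rV[R]_k => x *m U).
Proof.
apply: rV_continuous => i; under eq_fun do rewrite mxE.
apply: continuous_big; first exact: add_continuous.
by move=> j _ x; apply: cvgM; [exact: nbhs_filter|exact: (@coord_continuous R 1 k 0 j x)|exact: cst_continuous].
Qed.

Lemma compact_mulmx k q (U : 'M[R]_(k, q)) (A : set 'rV[R]_k) : compact A ->
  compact [set x *m U | x in A].
Proof. by apply: compact_image; exact: mulmx_continuous. Qed.

(** The first coordinate is preserved, and the slice at height [s] goes to a translate of its image
    under the remaining unit triangular block, to which induction applies. *)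
Lemma vol_unit_upper k (U : 'M[R]_k) (A : set 'rV[R]_k) :
  (forall i, U i i = 1) -> (forall i j : 'I_k, (j < i)%N -> U i j = 0) ->
  compact A -> vol [set x *m U | x in A] <= vol A.
Proof.
elim: k U A => [|k IH] U A U1 U0 cA.
  apply: le_vol; last exact: compact_coverable.
  by move=> _ [x Ax <-]; rewrite [x *m U](_ : _ = x)//; apply/rowP => -[].
pose V : 'M[R]_(1 + k) := U.
have ulV : ulsubmx V = 1%:M.
  by apply/matrixP => i j; rewrite !ord1 !mxE eqxx; exact: U1.
have dlV : dlsubmx V = 0.
  by apply/matrixP => i j; rewrite !mxE; apply: U0; rewrite /= ord1.
have cB := compact_mulmx cA (U := U).
rewrite -[leRHS]mul1r -[leRHS]addr0 -(mul0r (vol A)).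
apply: (@vol_fubini_le k k k) => // s; rewrite mul0r addr0 mul1r.
have cAs := compact_sec (y := cst1 s) (cA : compact (A : set 'rV[R]_(1 + k))).
apply: le_trans (IH (drsubmx V) _ _ _ cAs).
- apply: le_trans (vol_translate (cst1 s *m ursubmx V) _); last first.
    exact/compact_coverable/compact_mulmx.
  apply: le_vol; last first.
    apply: compact_coverable; apply: compact_image; last exact: compact_mulmx.
    by move=> x; apply: cvgD; [exact: nbhs_filter|exact: cvg_id|exact: cst_continuous].
  have mulV (x : 'rV[R]_(1 + k)) : x *m V = row_mx (cst1 (x 0 0))
      (rsubmx x *m drsubmx V + cst1 (x 0 0) *m ursubmx V).
    rewrite -{1}(row_mx_cst1 x) -{1}[V]submxK mul_row_block ulV dlV.
    by rewrite mulmx1 mulmx0 addr0 addrC.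
  move=> z [x Ax]; rewrite [_ *m _](mulV x) => e; have [<- <-] := @eq_row_mx R 1 1 k _ _ _ _ e.
  exists (rsubmx (x : 'rV[R]_(1 + k)) *m drsubmx V) => //.
  by exists (rsubmx (x : 'rV[R]_(1 + k))) => //; rewrite /sec /= row_mx_cst1.
- by move=> i; rewrite !mxE; exact: U1.
- by move=> i j ij; rewrite !mxE; apply: U0; rewrite /= !add1n ltnS.
Qed.

(** Reversing the order of the coordinates conjugates a lower triangular matrix into an upper
    triangular one. *)
Lemma vol_unit_lower k (L : 'M[R]_k) (A : set 'rV[R]_k) :
  (forall i, L i i = 1) -> (forall i j : 'I_k, (i < j)%N -> L i j = 0) ->
  compact A -> vol [set x *m L | x in A] <= vol A.
Proof.
move=> L1 L0 cA.
pose rv (x : 'rV[R]_k) : 'rV[R]_k := \row_i x 0 (rev_ord i).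
pose L' : 'M[R]_k := \matrix_(i, j) L (rev_ord i) (rev_ord j).
have rvK x : rv (rv x *m L') = x *m L.
  apply/rowP => j; rewrite !mxE (reindex_inj rev_ord_inj) /=; apply: eq_bigr => i _.
  by rewrite !mxE !rev_ordK.
have crv : continuous rv.
  by apply: rV_continuous => i; under eq_fun do rewrite mxE; exact: coord_continuous.
have brv : bijective (@rev_ord k) by exists (@rev_ord k); exact: rev_ordK.
have crA : compact [set rv x | x in A] by exact: compact_image.
apply: le_trans (vol_permute brv (compact_coverable cA)).
apply: le_trans (_ : _ <= vol [set x *m L' | x in [set rv x | x in A]]) _; last first.
  apply: vol_unit_upper => // [i|i j ij]; rewrite !mxE ?L1// L0//=.
  by apply: ltn_sub2l; [exact: leq_ltn_trans ij (ltn_ord i)|rewrite ltnS].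
apply: le_trans (vol_permute brv (compact_coverable (compact_mulmx crA (U := L')))).
apply: le_vol; last first.
  by apply: compact_coverable; apply: (@compact_image _ _ _ _ rv) => //; exact: compact_mulmx.
move=> _ [x Ax <-]; exists (rv x *m L'); last exact: rvK.
by exists (rv x) => //; exists x.
Qed.

Lemma det_upper k (U : 'M[R]_k) : (forall i j : 'I_k, (j < i)%N -> U i j = 0) ->
  \det U = \prod_i U i i.
Proof.
move=> U0; rewrite -det_tr det_trig; first by apply: eq_bigr => i _; rewrite mxE.
by apply/is_trig_mxP => i j ij; rewrite mxE U0.
Qed.

(** By the LUP decomposition, with the pivots split off from the upper factor, [Q] is a product of a
    permutation, two unit triangular matrices and a diagonal one. Only the last can change volume,
    by a factor [|\det Q|]. *)
Lemma vol_linear k (Q : 'M[R]_k.+1) (A : set 'rV[R]_k.+1) : `|\det Q| = 1 ->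
  compact A -> vol [set x *m Q | x in A] <= vol A.
Proof.
move=> detQ cA.
have := cormen_lup_correct Q; have := cormen_lup_detL Q; have := cormen_lup_perm Q.
have := @cormen_lup_lower _ _ Q; have := @cormen_lup_upper _ _ Q.
case: (cormen_lup Q) => [[P L] U] /= U0 L0 /is_perm_mxP[s ->] detL PQ.
have detU : `|\prod_i U i i| = 1.
  rewrite -det_upper//; have := congr1 (fun M => `|\det M|) PQ.
  by rewrite !det_mulmx detL mul1r det_perm normrM detQ mulr1 normrX normrN1 expr1n.
have Un0 i : U i i != 0.
  apply/eqP => Ui; move/eqP: detU; rewrite (bigD1 i)//= Ui mul0r normr0.
  by rewrite eq_sym oner_eq0.
pose U' : 'M[R]_k.+1 := \matrix_(i, j) (U i j / U i i).
have UE : U = diag_mx (\row_i U i i) *m U'.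
  by apply/matrixP => i j; rewrite mul_diag_mx !mxE mulrC divfK.
have QE : Q = perm_mx s^-1%g *m L *m (diag_mx (\row_i U i i) *m U').
  rewrite -UE -mulmxA [L *m U](_ : _ = perm_mx s *m Q); last exact/esym/PQ.
  by rewrite mulmxA -perm_mxM mulVg perm_mx1 mul1mx.
pose A1 := [set \row_i x 0 (s i) | x in A].
have cA1 : compact A1.
  apply: (@compact_image R k.+1 k.+1 A (fun x => \row_i x 0 (s i))) => //.
  by apply: rV_continuous => i; under eq_fun do rewrite mxE; exact: coord_continuous.
pose A2 := [set x *m L | x in A1]; have cA2 : compact A2 by exact: compact_mulmx.
pose A3 := [set x *m diag_mx (\row_i U i i) | x in A2].
have cA3 : compact A3 by exact: compact_mulmx.
have v1 : vol A1 <= vol A.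
  by apply: vol_permute; [exists (s^-1)%g => i; rewrite ?permK ?permKV|exact: compact_coverable].
have v2 : vol A2 <= vol A1.
  by apply: vol_unit_lower => // [i|i j ij]; rewrite L0 ?eqxx// ?(ltnW ij)// -val_eqE ltn_eqF.
have v3 : vol A3 <= vol A2.
  apply: le_trans (vol_diag _ (compact_coverable cA2)) _.
  by under eq_bigr do rewrite mxE; rewrite detU mul1r.
apply: le_trans (_ : _ <= vol [set x *m U' | x in A3]) _.
  apply: le_vol; last exact/compact_coverable/compact_mulmx.
  move=> _ [x Ax <-]; exists (x *m perm_mx s^-1%g *m L *m diag_mx (\row_i U i i)).
    exists (x *m perm_mx s^-1%g *m L) => //; exists (x *m perm_mx s^-1%g) => //.
    exists x => //; rewrite -col_permE; apply/rowP => i; by rewrite !mxE.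
  by rewrite QE !mulmxA.
apply: le_trans (vol_unit_upper _ _ cA3) _.
- by move=> i; rewrite mxE divff.
- by move=> i j ij; rewrite mxE U0// mul0r.
- exact/(le_trans v3)/(le_trans v2).
Qed.

End LinearInvariance.

(** * Hypographs, superlevel sets and the layer-cake formula *)

Section LayerCake.
Context {R : realType}.
Notation mu := (@lebesgue_measure R).

Lemma total_vol_dim0 (l : seq ('rV[R]_0 * 'rV[R]_0)) : total_vol l = (size l)%:R.
Proof.
rewrite /total_vol (eq_bigr (fun _ => 1)); last by move=> p _; rewrite /box_vol big_ord0.
by rewrite big_const_seq count_predT iter_addr addr0.
Qed.

Lemma vol_dim0 (A : set 'rV[R]_0) : A !=set0 -> vol A = 1.
Proof.
move=> [x Ax]; have cov : box_cover A [:: (x, x)].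
  split=> [p _ [] //|y _]; exists (x, x); [exact: mem_head|by move=> []].
apply/eqP; rewrite eq_le; apply/andP; split.
  by apply: le_trans (vol_le_total cov) _; rewrite total_vol_dim0.
apply: le_vol_cover => [|[|p l] [_ Al]]; first by exists [:: (x, x)].
  by have [] := Al _ Ax.
by rewrite total_vol_dim0 ler1n.
Qed.

Definition itv_rV (a b : R) : set 'rV[R]_1 := [set x | a <= x 0 0 <= b].

Lemma compact_itv_rV a b : compact (itv_rV a b).
Proof.
have := @rV_compact R 1 (fun=> `[a, b]%classic) (fun=> @segment_compact R a b).
congr (compact _); apply/seteqP; split => x /=.
  by move=> /(_ 0); rewrite /= in_itv.
by move=> xab i; rewrite (ord1 i) in_itv; exact: xab.
Qed.

Lemma vol_itv_rV a b : a <= b -> vol (itv_rV a b) = b - a.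
Proof.
move=> ab; have cI := @compact_itv_rV a b.
apply: EFin_inj; rewrite (@vol_fubini R 0)//.
transitivity (\int[mu]_s (\1_(`[a, b]%classic) s)%:E)%E.
  apply: eq_integral => s _; rewrite indicE; congr EFin.
  have E z : sec (itv_rV a b : set 'rV[R]_(1 + 0)) (cst1 s) z = (a <= s <= b) :> Prop.
    by rewrite /sec /itv_rV /= (cst1_row_mxE s z).
  have [h|h] := boolP (a <= s <= b).
    by rewrite mem_set /= ?in_itv// vol_dim0//; exists 0; rewrite E.
  rewrite memNset /= ?in_itv; last exact/negP.
  by rewrite (_ : sec _ _ = set0) ?vol0//; apply/seteqP; split => // z; rewrite E (negbTE h).
have -> : (\int[mu]_s (\1_(`[a, b]%classic) s)%:E = mu `[a, b]%classic)%E.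
  by rewrite integral_indic// setIT.
rewrite lebesgue_measure_itv /= lte_fin.
by move: ab; rewrite le_eqVlt => /predU1P[->|->//]; rewrite ltxx subrr.
Qed.

Lemma rV1_cst1 (x : 'rV[R]_1) : cst1 (x 0 0) = x.
Proof. by apply/rowP => i; rewrite !mxE ord1. Qed.

Definition swap_row m p (x : 'rV[R]_(m + p)) : 'rV[R]_(p + m) :=
  row_mx (rsubmx x) (lsubmx x).

Lemma swap_rowK m p (x : 'rV[R]_(m + p)) : swap_row (swap_row x) = x.
Proof. by rewrite /swap_row row_mxKl row_mxKr hsubmxK. Qed.

Definition swap_ord m p (i : 'I_(p + m)) : 'I_(m + p) :=
  match fintype.split i with inl a => rshift m a | inr b => lshift p b end.

Lemma swap_ordK m p (i : 'I_(p + m)) : @swap_ord p m (@swap_ord m p i) = i.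
Proof.
rewrite /swap_ord; case: (split_ordP i) => j ->.
  by rewrite (unsplitK (inr j)).
by rewrite (unsplitK (inl j)).
Qed.

Lemma vol_swap_le m p (A : set 'rV[R]_(m + p)) : compact A ->
  vol [set swap_row x | x in A] <= vol A.
Proof.
move=> cA.
have bs : bijective (@swap_ord m p).
  by exists (@swap_ord p m) => i; rewrite swap_ordK.
apply: le_trans (vol_permute bs (compact_coverable cA)).
rewrite (_ : [set swap_row x | x in A] = [set \row_i x 0 (swap_ord i) | x in A])//.
apply: eq_imagel => x _; apply/rowP => i; rewrite !mxE /swap_ord.
by case: (fintype.split i) => j; rewrite mxE.
Qed.

Lemma swap_row_continuous m p : continuous (@swap_row m p).
Proof.
apply: rV_continuous => i; case: (split_ordP i) => j ->.
  by under eq_fun do rewrite row_mxEl mxE; exact: coord_continuous.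
by under eq_fun do rewrite row_mxEr mxE; exact: coord_continuous.
Qed.

Lemma vol_swap m p (A : set 'rV[R]_(m + p)) : compact A ->
  vol [set swap_row x | x in A] = vol A.
Proof.
move=> cA; apply/eqP; rewrite eq_le vol_swap_le//=.
have cS : compact [set swap_row x | x in A].
  by apply: compact_image => //; exact: swap_row_continuous.
rewrite -[X in vol X <= _](_ : [set swap_row x | x in [set swap_row x | x in A]] = A).
  exact: vol_swap_le.
apply/seteqP; split=> [_ [_ [x Ax <-] <-]|x Ax]; first by rewrite swap_rowK.
by exists (swap_row x); [exists x|exact: swap_rowK].
Qed.

Definition shadow m p (K : set 'rV[R]_(m + p)) : set 'rV[R]_m :=
  [set y | sec K y !=set0].

Lemma shadowE m p (K : set 'rV[R]_(m + p)) : shadow K = [set lsubmx x | x in K].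
Proof.
apply/seteqP; split=> [y [z Kz]|_ [x Kx <-]].
  by exists (row_mx y z) => //; rewrite row_mxKl.
by exists (rsubmx x); rewrite /sec /= hsubmxK.
Qed.

Lemma compact_shadow m p (K : set 'rV[R]_(m + p)) : compact K -> compact (shadow K).
Proof.
by move=> cK; rewrite shadowE; apply: compact_image => //; exact: continuous_lsubmx.
Qed.

(** Heights are counted in units of [c]: in Brunn-Minkowski, where [A] and [B] use their largest
    slice volume as [c], they run over the unit interval. Negative heights give the empty set,
    height 0 the whole shadow. *)
Definition superlevel m p (K : set 'rV[R]_(m + p)) (c t : R) : set 'rV[R]_m :=
  [set y | [/\ shadow K y, 0 <= t & c * t <= vol (sec K y)]].

Definition hypograph m p (K : set 'rV[R]_(m + p)) (c : R) : set 'rV[R]_(m + 1) :=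
  [set x | superlevel K c (rsubmx x 0 0) (lsubmx x)].

Lemma vol_sec_bounded m p (K : set 'rV[R]_(m + p)) : compact K ->
  exists2 V, 0 <= V & forall y, vol (sec K y) <= V.
Proof.
move=> cK; exists (vol (rsubmx @` K)); first exact: vol_ge0.
move=> y; apply: le_vol; first by move=> z Kz; exists (row_mx y z); rewrite ?row_mxKr.
by apply/compact_coverable/compact_image => //; exact: continuous_rsubmx.
Qed.

Lemma compact_hypograph m p (K : set 'rV[R]_(m + p)) c : 0 < c -> compact K ->
  compact (hypograph K c).
Proof.
move=> c0 cK; have [V V0 HV] := vol_sec_bounded cK.
have cP := compact_shadow cK.
have := compact_setX cP (@segment_compact R 0 (V / c)).
move=> /(@continuous_compact _ _ (fun x : 'rV[R]_m * R => row_mx x.1 (cst1 x.2))).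
have cf : continuous (fun x : 'rV[R]_m * R => row_mx x.1 (cst1 x.2)).
  apply: rV_continuous => i x; case: (split_ordP i) => j ->.
    under eq_fun do rewrite row_mxEl.
    by apply: (@continuous_comp _ _ _ fst (fun y : 'rV[R]_m => y 0 j));
      [exact: cvg_fst|exact: coord_continuous].
  by under eq_fun do rewrite row_mxEr mxE; exact: cvg_snd.
move=> /(_ (continuous_subspaceT cf)) /subclosed_compact; apply; last first.
  move=> x [Px t0 ct]; exists (lsubmx x, rsubmx x 0 0).
    by split => //=; rewrite in_itv /= t0 ler_pdivlMr// mulrC (le_trans ct).
  by rewrite /= rV1_cst1 hsubmxK.
have cr : continuous (fun x : 'rV[R]_(m + 1) => rsubmx x 0 0).
  by under eq_fun do rewrite mxE; exact: coord_continuous.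
(* With [F y] the fibre volume, [c t <= F y] holds iff every [d] satisfies [c t <= d] or [d <= F y].
   By upper semicontinuity both alternatives are closed, so this is an intersection of closed
   sets. *)
rewrite (_ : hypograph K c = (lsubmx @^-1` shadow K `&` [set x | 0 <= rsubmx x 0 0]) `&`
  \bigcap_(d in setT) ([set x | c * rsubmx x 0 0 <= d] `|`
    lsubmx @^-1` [set y | d <= vol (sec K y)])).
  apply: closedI; first apply: closedI.
  - apply: preimage_closed; first by move=> x _; exact: continuous_lsubmx.
    by apply: compact_closed => //; exact: rV_hausdorff.
  - by apply: (@preimage_closed _ _ _ [set t : R | 0 <= t]); [move=> x _; exact: cr|exact: closed_ge].
  - apply: closed_bigI => d _; apply: closedU.
      apply: (@preimage_closed _ _ (fun x : 'rV[R]_(m + 1) => c * rsubmx x 0 0) [set t : R | t <= d]).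
        by move=> x _; apply: cvgM; [exact: nbhs_filter|exact: cst_continuous|exact: cr].
      exact: closed_le.
    apply: preimage_closed; first by move=> x _; exact: continuous_lsubmx.
    exact: closed_vol_sec.
apply/seteqP; split=> x.
  move=> [Px t0 ct]; split => // d _ /=.
  have [|dF] := leP d (vol (sec K (lsubmx x))); first by right.
  by left; apply: le_trans ct (ltW dF).
move=> [[Px t0] h]; split => //; rewrite leNgt; apply/negP => lt.
have := h ((vol (sec K (lsubmx x)) + c * rsubmx x 0 0) / 2) I; case=> /=; lra.
Qed.

Lemma sec_hypograph m p (K : set 'rV[R]_(m + p)) c (y : 'rV[R]_m) : 0 < c ->
  vol (sec (hypograph K c) y) = vol (sec K y) / c.
Proof.
move=> c0; have [Py|nPy] := pselect (shadow K y); last first.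
  rewrite (_ : sec (hypograph K c) y = set0).
    rewrite (_ : sec K y = set0) ?vol0 ?mul0r//.
    by apply/seteqP; split => // z Kz; apply: nPy; exists z.
  by apply/seteqP; split => // t; rewrite /sec /hypograph /= row_mxKl; case.
rewrite (_ : sec _ _ = itv_rV 0 (vol (sec K y) / c)).
  by rewrite vol_itv_rV ?subr0// divr_ge0 ?vol_ge0// ltW.
apply/seteqP; split => t; rewrite /sec /hypograph /superlevel /itv_rV /= row_mxKl row_mxKr.
  by case=> _ -> /=; rewrite ler_pdivlMr// mulrC.
by case/andP => t0; rewrite ler_pdivlMr// mulrC.
Qed.

(** Cavalieri's principle: the fibres over each base point have proportional volumes, and
    [vol_sec_le] applies in both directions. *)
Lemma vol_hypograph m p (K : set 'rV[R]_(m + p)) c : 0 < c -> compact K ->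
  vol (hypograph K c) = vol K / c.
Proof.
move=> c0 cK; have cH := compact_hypograph c0 cK; apply/eqP; rewrite eq_le; apply/andP; split.
  have := @vol_sec_le R m 1 p p (hypograph K c) K K c^-1 0 cH cK cK.
  rewrite mul0r addr0 mulrC; apply => //; first by rewrite invr_ge0 ltW.
  by move=> y; rewrite sec_hypograph// mul0r addr0 mulrC.
rewrite ler_pdivrMr// mulrC.
have := @vol_sec_le R m p 1 p K (hypograph K c) K c 0 cK cH cK.
rewrite mul0r addr0; apply => //; first exact: ltW.
by move=> y; rewrite sec_hypograph// mul0r addr0 mulrC divfK// gt_eqF.
Qed.

(** The height is moved to the front so that slicing by the first coordinate yields the superlevel
    sets; [vol_fubini] then becomes the layer-cake formula. *)
Definition levels m p (K : set 'rV[R]_(m + p)) (c : R) : set 'rV[R]_(1 + m) :=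
  [set swap_row x | x in hypograph K c].

Lemma compact_levels m p (K : set 'rV[R]_(m + p)) c : 0 < c -> compact K ->
  compact (levels K c).
Proof.
move=> c0 cK; apply: compact_image; [exact: swap_row_continuous|exact: compact_hypograph].
Qed.

Lemma sec_levels m p (K : set 'rV[R]_(m + p)) c t :
  sec (levels K c) (cst1 t) = superlevel K c t.
Proof.
apply/seteqP; split=> y.
  rewrite /sec /= => -[x Hx e].
  have : swap_row (swap_row x) = row_mx y (cst1 t) by rewrite e /swap_row row_mxKl row_mxKr.
  rewrite swap_rowK => xE; move: Hx.
  by rewrite xE /hypograph /= row_mxKl row_mxKr mxE.
move=> Hy; rewrite /sec /=; exists (row_mx y (cst1 t)).
  by rewrite /hypograph /= row_mxKl row_mxKr mxE.
by rewrite /swap_row row_mxKl row_mxKr.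
Qed.

Lemma vol_levels m p (K : set 'rV[R]_(m + p)) c : 0 < c -> compact K ->
  vol (levels K c) = vol K / c.
Proof. by move=> c0 cK; rewrite vol_swap ?vol_hypograph//; exact: compact_hypograph. Qed.

Lemma compact_superlevel m p (K : set 'rV[R]_(m + p)) c t : 0 < c -> compact K ->
  compact (superlevel K c t).
Proof. by move=> c0 cK; rewrite -sec_levels; apply/compact_sec/compact_levels. Qed.

End LayerCake.

(** * The Brunn-Minkowski inequality *)

Section BrunnMinkowski.
Context {R : realType}.
Notation mu := (@lebesgue_measure R).

Definition is_convex k (A : set 'rV[R]_k) := forall x y (t : R),
  A x -> A y -> 0 <= t <= 1 -> A (t *: x + (1 - t) *: y).

Lemma nth_root_exists k (a : R) : (0 < k)%N -> 0 <= a -> exists2 r, 0 <= r & r ^+ k = a.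
Proof.
move=> k0 a0; exists (a `^ k%:R^-1); first exact: powR_ge0.
by rewrite -powR_mulrn ?powR_ge0// -powRrM mulVf ?powRr1// pnatr_eq0 -lt0n.
Qed.

Lemma exprn_chebyshev k (a b : R) : 0 <= a -> 0 <= b ->
  0 <= (a ^+ k - b ^+ k) * (a - b).
Proof.
move=> a0 b0; wlog ab : a b a0 b0 / a <= b.
  move=> H; have [ab|ab] := leP a b; first exact: H.
  by have := H _ _ b0 a0 (ltW ab); rewrite -mulrNN !opprB.
by rewrite -mulrNN !opprB mulr_ge0 ?subr_ge0// lerXn2r.
Qed.

Lemma exprn_convex k (l a b : R) : 0 <= l <= 1 -> 0 <= a -> 0 <= b ->
  (l * a + (1 - l) * b) ^+ k <= l * a ^+ k + (1 - l) * b ^+ k.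
Proof.
move=> /andP[l0 l1] a0 b0; elim: k => [|k IH]; first by rewrite !expr0; lra.
have c0 : 0 <= l * a + (1 - l) * b by rewrite addr_ge0// mulr_ge0// subr_ge0.
rewrite exprSr; apply: le_trans (ler_wpM2r c0 IH) _.
rewrite -subr_ge0 (_ : _ - _ = l * (1 - l) * ((a ^+ k - b ^+ k) * (a - b))).
  by rewrite mulr_ge0 ?exprn_chebyshev// mulr_ge0// subr_ge0.
by rewrite !exprSr; ring.
Qed.

Lemma wsum_gt0 (a b p q : R) : 0 <= a -> 0 <= b -> 0 < a + b -> 0 < p -> 0 < q ->
  0 < a * p + b * q.
Proof.
move=> a0 b0 ab p0 q0; move: a0; rewrite le_eqVlt => /predU1P[a0|a0].
  by rewrite -a0 mul0r add0r mulr_gt0//; move: ab; rewrite -a0 add0r.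
by apply: ltr_pwDl; [exact: mulr_gt0|apply: mulr_ge0 => //; exact: ltW].
Qed.

(** Radon's inequality: convexity of the power [k + 1] at the points [x / p] and [y / q], with
    weights proportional to [a p] and [b q]. It converts the linear bound for normalised volumes
    into the Brunn-Minkowski form. *)
Lemma radon_ineq k (a b x y p q : R) : 0 <= a -> 0 <= b -> 0 < a + b ->
  0 <= x -> 0 <= y -> 0 < p -> 0 < q ->
  (a * x + b * y) ^+ k.+1 <=
  (a * p + b * q) ^+ k * (a * (x ^+ k.+1 / p ^+ k) + b * (y ^+ k.+1 / q ^+ k)).
Proof.
move=> a0 b0 ab x0 y0 p0 q0; have s0 := wsum_gt0 a0 b0 ab p0 q0.
set s := a * p + b * q in s0 *.
have l01 : 0 <= a * p / s <= 1.
  by rewrite divr_ge0 ?(ltW s0) ?mulr_ge0 ?(ltW p0)//= ler_pdivrMr// mul1r lerDl mulr_ge0// ltW.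
have := @exprn_convex k.+1 _ (x / p) (y / q) l01 (divr_ge0 x0 (ltW p0)) (divr_ge0 y0 (ltW q0)).
have pn0 : p != 0 by rewrite gt_eqF.
have qn0 : q != 0 by rewrite gt_eqF.
have sn0 : s != 0 by rewrite gt_eqF.
have pkn0 : p ^+ k != 0 by rewrite expf_neq0.
have qkn0 : q ^+ k != 0 by rewrite expf_neq0.
have skn0 : s ^+ k != 0 by rewrite expf_neq0.
have -> : 1 - a * p / s = b * q / s by rewrite -{1}(divff sn0) -mulrBl /s addrAC subrr add0r.
rewrite (_ : _ + _ = (a * x + b * y) / s); last by field; rewrite pn0 qn0 sn0.
rewrite !expr_div_n ler_pdivrMr ?exprn_gt0// => /le_trans; apply.
rewrite le_eqVlt; apply/orP; left; apply/eqP.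
by rewrite !(exprSr p) !(exprSr q) !(exprSr s); field; rewrite pn0 qn0 sn0 pkn0 qkn0.
Qed.

Lemma convex_sec m p (K : set 'rV[R]_(m + p)) y1 y2 z1 z2 (t : R) : is_convex K ->
  0 <= t <= 1 -> sec K y1 z1 -> sec K y2 z2 ->
  sec K (t *: y1 + (1 - t) *: y2) (t *: z1 + (1 - t) *: z2).
Proof.
by move=> cK t01 K1 K2; rewrite /sec /= -add_row_mx -!scale_row_mx; exact: cK.
Qed.

Lemma is_convex_sec m p (K : set 'rV[R]_(m + p)) y : is_convex K -> is_convex (sec K y).
Proof.
move=> cK z1 z2 t K1 K2 t01; have := convex_sec cK t01 K1 K2.
by rewrite -scalerDl addrC subrK scale1r.
Qed.

(** The maximum is read off a highest point of the compact hypograph, so upper semicontinuity is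
    enough. *)
Lemma max_vol_sec m p (K : set 'rV[R]_(m + p)) : compact K -> K !=set0 ->
  exists2 y0, shadow K y0 & forall y, vol (sec K y) <= vol (sec K y0).
Proof.
move=> cK [x0 Kx0]; have cH := @compact_hypograph R m p K 1 ltr01 cK.
have H y : shadow K y -> hypograph K 1 (row_mx y (cst1 (vol (sec K y)))).
  by move=> Py; rewrite /hypograph /superlevel /= row_mxKl row_mxKr mxE mul1r vol_ge0.
have P0 : shadow K (lsubmx x0) by exists (rsubmx x0); rewrite /sec /= hsubmxK.
have [||h hH hmax] := @compact_EVT_max _ R (fun x : 'rV[R]_(m + 1) => rsubmx x 0 0)
  (hypograph K 1) _ cH.
- by exists (row_mx (lsubmx x0) (cst1 (vol (sec K (lsubmx x0))))); exact: H.
- by apply: continuous_subspaceT => x; under eq_fun do rewrite mxE; exact: coord_continuous.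
have := set_mem hH; rewrite /hypograph /superlevel /= mul1r => -[Ph h0 hvol].
exists (lsubmx h) => // y; apply: le_trans hvol.
have [Py|nPy] := pselect (shadow K y).
  by have := hmax _ (mem_set (H _ Py)); rewrite /= row_mxKr mxE.
rewrite (_ : sec K y = set0) ?vol0//.
by apply/seteqP; split => // z Kz; apply: nPy; exists z.
Qed.

Lemma rV1_endpoints (X : set 'rV[R]_1) : compact X -> X !=set0 ->
  exists x1 x2, [/\ X x1, X x2 & forall x, X x -> x1 0 0 <= x 0 0 <= x2 0 0].
Proof.
move=> cX X0.
have cc : {within X, continuous (fun x : 'rV[R]_1 => x 0 0)}.
  by apply: continuous_subspaceT; exact: coord_continuous.
have [x1 X1 m1] := compact_EVT_min X0 cX cc; have [x2 X2 m2] := compact_EVT_max X0 cX cc.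
exists x1, x2; split; [exact: set_mem|exact: set_mem|move=> x /mem_set Xx].
by rewrite m1 ?m2.
Qed.

(** Only extreme points of [A] and [B] matter: [C] contains the combination of the lower ones and
    that of the upper ones, and by convexity the segment between. *)
Lemma brunn_minkowski_dim1 (A B C : set 'rV[R]_1) (a b : R) :
  compact A -> compact B -> compact C -> is_convex C -> A !=set0 -> B !=set0 ->
  0 <= a -> 0 <= b ->
  (forall u w, A u -> B w -> C (a *: u + b *: w)) ->
  a * vol A + b * vol B <= vol C.
Proof.
move=> cA cB cC vC A0 B0 a0 b0 ABC.
have [u1 [u2 [Au1 Au2 Au]]] := rV1_endpoints cA A0.
have [w1 [w2 [Bw1 Bw2 Bw]]] := rV1_endpoints cB B0.
have u12 : u1 0 0 <= u2 0 0 by have /andP[] := Au _ Au2.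
have w12 : w1 0 0 <= w2 0 0 by have /andP[] := Bw _ Bw2.
have vA : vol A <= u2 0 0 - u1 0 0.
  by rewrite -vol_itv_rV//; apply: le_vol => //; exact/compact_coverable/compact_itv_rV.
have vB : vol B <= w2 0 0 - w1 0 0.
  by rewrite -vol_itv_rV//; apply: le_vol => //; exact/compact_coverable/compact_itv_rV.
pose c1 := a * u1 0 0 + b * w1 0 0; pose c2 := a * u2 0 0 + b * w2 0 0.
have c12 : c1 <= c2 by rewrite lerD// ler_wpM2l.
apply: (@le_trans _ _ (c2 - c1)).
  by apply: le_trans (lerD (ler_wpM2l a0 vA) (ler_wpM2l b0 vB)) _; rewrite /c1 /c2; lra.
rewrite -vol_itv_rV//; apply: le_vol; last exact: compact_coverable.
move=> x /andP[x1 x2].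
have [e|ne] := eqVneq c1 c2.
  rewrite (_ : x = a *: u1 + b *: w1); first exact: ABC.
  apply/rowP => i; rewrite !mxE !ord1; apply: le_anti.
  by rewrite -/c1 x1 andbT e.
have d0 : 0 < c2 - c1 by rewrite subr_gt0 lt_neqAle ne.
pose t := (c2 - x 0 0) / (c2 - c1).
have t01 : 0 <= t <= 1.
  by rewrite /t divr_ge0 ?subr_ge0//= ler_pdivrMr// mul1r lerB.
rewrite (_ : x = t *: (a *: u1 + b *: w1) + (1 - t) *: (a *: u2 + b *: w2)).
  by apply: vC => //; exact: ABC.
apply/rowP => i; rewrite !mxE !ord1 -/c1 -/c2 /t.
by field; rewrite gt_eqF.
Qed.

Lemma convex_superlevel m p (K : set 'rV[R]_(m + p)) c t : is_convex K ->
  (forall y1 y2 l, 0 < t -> 0 <= l <= 1 -> c * t <= vol (sec K y1) ->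
     c * t <= vol (sec K y2) -> shadow K y1 -> shadow K y2 ->
     c * t <= vol (sec K (l *: y1 + (1 - l) *: y2))) ->
  is_convex (superlevel K c t).
Proof.
move=> vK H y1 y2 l [P1 t0 l1] [P2 _ l2] l01; split => //.
  case: P1 => z1 Kz1; case: P2 => z2 Kz2; exists (l *: z1 + (1 - l) *: z2).
  exact: convex_sec.
move: t0; rewrite le_eqVlt => /predU1P[<-|t0]; first by rewrite mulr0 vol_ge0.
exact: H.
Qed.

Lemma superlevel_eq0 m p (K : set 'rV[R]_(m + p)) c t :
  (forall y, vol (sec K y) < c * t) -> superlevel K c t = set0.
Proof.
by move=> h; apply/seteqP; split => // y [_ _]; rewrite leNgt h.
Qed.

Lemma slice_max k (A : set 'rV[R]_(1 + k)) : compact A -> 0 < vol A ->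
  exists p, [/\ 0 < p, forall s, vol (sec A s) <= p ^+ k &
    exists2 s, shadow A s & vol (sec A s) = p ^+ k].
Proof.
move=> cA vA; have A0 : A !=set0.
  by apply/set0P; apply: contraTneq vA => ->; rewrite vol0 ltxx.
have [s Ps maxs] := max_vol_sec cA A0.
have s0 : 0 < vol (sec A s).
  rewrite lt_neqAle vol_ge0 andbT; apply: contraTneq vA => s0.
  rewrite -leNgt; have := @vol_sec_le R 1 k k k A A A 0 0 cA cA cA (lexx _) (lexx _).
  by rewrite !mul0r addr0; apply => y; rewrite !mul0r addr0 s0.
suff [p p0 pk] : exists2 p, 0 < p & p ^+ k = vol (sec A s).
  by exists p; split=> // [y|]; [rewrite pk|exists s].
move: Ps s0; case: (k) A cA A0 s maxs {vA} => [|k'] A' cA A0 s maxs Ps s0.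
  by exists 1 => //; rewrite vol_dim0.
have [r r0 rk] := nth_root_exists (ltn0Sn k') (ltW s0).
exists r => //; rewrite lt_neqAle r0 andbT; apply: contraTneq s0 => r00.
by rewrite -rk -r00 expr0n ltxx.
Qed.

(* Induction on the dimension.  The slice volumes of [A] and [B] are normalised
   by their maxima [p ^ k] and [q ^ k]; at each relative height the superlevel
   sets satisfy the one-dimensional inequality, which is then integrated. *)
Lemma brunn_minkowski k (A B C : set 'rV[R]_k) (a b x y : R) :
  compact A -> compact B -> compact C -> is_convex C ->
  0 <= a -> 0 <= b -> 0 < a + b -> 0 < x -> 0 < y ->
  A !=set0 -> B !=set0 ->
  (forall u w, A u -> B w -> C (a *: u + b *: w)) ->
  x ^+ k <= vol A -> y ^+ k <= vol B ->
  (a * x + b * y) ^+ k <= vol C.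
Proof.
elim: k A B C a b x y => [|k IH] A B C a b x y cA cB cC vC a0 b0 ab0 x0 y0 A0 B0 ABC xA yB.
  rewrite expr0 vol_dim0//; case: A0 => u Au; case: B0 => w Bw.
  by exists (a *: u + b *: w); exact: ABC.
have [p [p0 pA [sA PsA volsA]]] := @slice_max k A cA (lt_le_trans (exprn_gt0 _ x0) xA).
have [q [q0 qB [sB PsB volsB]]] := @slice_max k B cB (lt_le_trans (exprn_gt0 _ y0) yB).
have w0 := wsum_gt0 a0 b0 ab0 p0 q0.
pose r := (a * p + b * q) ^+ k; have r0 : 0 < r by rewrite exprn_gt0.
(* At height [t] the induction hypothesis is applied with radii scaled by [g], where [g ^ k = t].
   For [k = 0] there is in general no such [g], but nonempty slices are then points of volume 1 and
   [g = 1] serves. *)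
have root (t : R) : 0 < t <= 1 -> exists2 g, 0 < g &
    g ^+ k = if k is 0%N then 1 else t.
  case: (k) => [|k'] /andP[t0 _]; first by exists 1.
  have [g g0 gk] := nth_root_exists (ltn0Sn k') (ltW t0).
  exists g => //; rewrite lt_neqAle g0 andbT; apply: contraTneq t0 => g00.
  by rewrite -gk -g00 expr0n ltxx.
have slice (K : set 'rV[R]_(1 + k)) (c g t : R) y1 : 0 < t <= 1 ->
    g ^+ k = (if k is 0%N then 1 else t) -> shadow K y1 -> c ^+ k * t <= vol (sec K y1) ->
    (c * g) ^+ k <= vol (sec K y1).
  rewrite exprMn; case: (k) K y1 => [|k'] K y1 /andP[t0 t1] -> Py //.
  by rewrite expr0 mul1r vol_dim0.
have scaled (c g t : R) : 0 < t <= 1 -> g ^+ k = (if k is 0%N then 1 else t) ->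
    c ^+ k * t <= (c * g) ^+ k.
  by rewrite exprMn; case: (k) => [|k'] /andP[t0 t1] ->; rewrite ?expr0 ?mul1r.
have lev_mem t y1 y2 : 0 <= t <= 1 -> superlevel (A : set 'rV[R]_(1 + k)) (p ^+ k) t y1 ->
    superlevel (B : set 'rV[R]_(1 + k)) (q ^+ k) t y2 ->
    superlevel (C : set 'rV[R]_(1 + k)) r t (a *: y1 + b *: y2).
  move=> /andP[t0 t1] [P1 _ l1] [P2 _ l2]; split => //.
    case: P1 => z1 Az1; case: P2 => z2 Bz2; exists (a *: z1 + b *: z2).
    by rewrite /sec /= -add_row_mx -!scale_row_mx; exact: ABC.
  move: t0; rewrite le_eqVlt => /predU1P[<-|t0]; first by rewrite mulr0 vol_ge0.
  have t01 : 0 < t <= 1 by rewrite t0.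
  have [g g0 gk] := root _ t01.
  rewrite /r; apply: le_trans (scaled (a * p + b * q) g t t01 gk) _.
  rewrite mulrDl -!mulrA; apply: (IH (sec (A : set 'rV[R]_(1 + k)) y1)
    (sec (B : set 'rV[R]_(1 + k)) y2)) => //.
  - exact: (@compact_sec R 1 k A y1).
  - exact: (@compact_sec R 1 k B y2).
  - exact: (@compact_sec R 1 k C).
  - exact: (@is_convex_sec 1 k C).
  - exact: mulr_gt0.
  - exact: mulr_gt0.
  - move=> u w Au Bw; rewrite /sec /= -add_row_mx -!scale_row_mx; exact: ABC.
  - exact: slice t01 gk P1 l1.
  - exact: slice t01 gk P2 l2.
(* This is the induction hypothesis for two slices of [C] and the slice between them, with equal
   radii. *)
have lev_convex t : t <= 1 -> is_convex (superlevel (C : set 'rV[R]_(1 + k)) r t).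
  move=> t1; apply: (@convex_superlevel 1 k) => // y1 y2 l t0 l01 l1 l2 P1 P2.
  have t01 : 0 < t <= 1 by rewrite t0.
  have [g g0 gk] := root _ t01.
  rewrite /r; apply: le_trans (scaled (a * p + b * q) g t t01 gk) _.
  have := IH (sec (C : set 'rV[R]_(1 + k)) y1) (sec (C : set 'rV[R]_(1 + k)) y2)
    (sec (C : set 'rV[R]_(1 + k)) (l *: y1 + (1 - l) *: y2)) l (1 - l)
    ((a * p + b * q) * g) ((a * p + b * q) * g).
  have -> : l * ((a * p + b * q) * g) + (1 - l) * ((a * p + b * q) * g) =
    (a * p + b * q) * g by ring.
  have /andP[ll0 ll1] := l01.
  apply => //.
  - exact: (@compact_sec R 1 k C).
  - exact: (@compact_sec R 1 k C).
  - exact: (@compact_sec R 1 k C).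
  - exact: (@is_convex_sec 1 k C).
  - by rewrite subr_ge0.
  - by rewrite addrC subrK.
  - exact: mulr_gt0.
  - exact: mulr_gt0.
  - by move=> u w; exact: (@convex_sec 1 k C).
  - exact: slice t01 gk P1 l1.
  - exact: slice t01 gk P2 l2.
have pk0 : 0 < p ^+ k by rewrite exprn_gt0.
have qk0 : 0 < q ^+ k by rewrite exprn_gt0.
have lev_ge t : a * vol (superlevel (A : set 'rV[R]_(1 + k)) (p ^+ k) t) +
    b * vol (superlevel (B : set 'rV[R]_(1 + k)) (q ^+ k) t) <=
    vol (superlevel (C : set 'rV[R]_(1 + k)) r t).
  (* Above height 1 the superlevel sets of [A] and [B] are empty, as [p ^ k] and [q ^ k] bound the
     slices; below 0 all three are. In between they contain [sA] and [sB], the positions of largest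
     slices, so the one-dimensional inequality applies. *)
  have [t1|t1] := leP t 1; last first.
    rewrite (@superlevel_eq0 1 k A) => [|s]; last first.
      by apply: le_lt_trans (pA s) _; rewrite ltr_pMr.
    rewrite (@superlevel_eq0 1 k B) => [|s]; last first.
      by apply: le_lt_trans (qB s) _; rewrite ltr_pMr.
    by rewrite vol0 !mulr0 addr0 vol_ge0.
  have [t0|t0] := leP 0 t; last first.
    have e K c : superlevel (K : set 'rV[R]_(1 + k)) c t = set0.
      by apply/seteqP; split => // s [_]; rewrite leNgt t0.
    by rewrite !e vol0 !mulr0 addr0.
  apply: brunn_minkowski_dim1 => //.
  - exact: (@compact_superlevel R 1 k).
  - exact: (@compact_superlevel R 1 k).
  - exact: (@compact_superlevel R 1 k).
  - exact: lev_convex.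
  - by exists sA; split => //; rewrite volsA ler_piMr// ltW.
  - by exists sB; split => //; rewrite volsB ler_piMr// ltW.
  - by move=> u w; apply: lev_mem; rewrite t0.
have := @vol_fubini_ge R 1 1 1 (levels (C : set 'rV[R]_(1 + k)) r)
  (levels (A : set 'rV[R]_(1 + k)) (p ^+ k)) (levels (B : set 'rV[R]_(1 + k)) (q ^+ k)) a b.
rewrite !vol_levels// => /(_ (@compact_levels R 1 k C _ r0 cC) (@compact_levels R 1 k A _ pk0 cA)
  (@compact_levels R 1 k B _ qk0 cB) a0 b0) H.
have {}H : a * (vol A / p ^+ k) + b * (vol B / q ^+ k) <= vol C / r.
  by apply: H => s; rewrite !sec_levels; exact: lev_ge.
apply: le_trans (radon_ineq k a0 b0 ab0 (ltW x0) (ltW y0) p0 q0) _.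
rewrite mulrC -ler_pdivlMr// -/r; apply: le_trans H.
by apply: lerD; apply: ler_wpM2l => //; rewrite ler_pM2r// invr_gt0.
Qed.

End BrunnMinkowski.

(** * Moments of the cone profile and the single-crossing comparison *)

Section Crossing.
Context {R : realType}.
Notation mu := (@lebesgue_measure R).

Lemma integral_deriv_poly (P : {poly R}) (T : R) : 0 < T ->
  (\int[mu]_(x in `[0%R, T]) (P^`().[x])%:E = (P.[T] - P.[0])%:E)%E.
Proof.
move=> T0; rewrite (@continuous_FTC2 _ (horner P^`()) (horner P))//.
- by apply: continuous_subspaceT; exact: continuous_horner.
- split; first by move=> x _; exact: derivable_horner.
    by apply: cvg_at_right_filter; exact: continuous_horner.
  by apply: cvg_at_left_filter; exact: continuous_horner.
- by move=> x _; rewrite -derive.derivE.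
Qed.

Definition cone_profile (v T : R) m (t : R) : R :=
  if 0 <= t <= T then v * (1 - t / T) ^+ m else 0.

Lemma cone_profile_ge0 (v T : R) m t : 0 <= v -> 0 < T -> 0 <= cone_profile v T m t.
Proof.
move=> v0 T0; rewrite /cone_profile; case: ifP => // /andP[t0 tT].
by rewrite mulr_ge0// exprn_ge0// subr_ge0 ler_pdivrMr// mul1r.
Qed.

Lemma integral_poly_itv (P Q : {poly R}) (T : R) (f : R -> R) : 0 < T ->
  (forall t, f t = if 0 <= t <= T then Q.[t] else 0) -> (forall t, Q.[t] = P^`().[t]) ->
  measurable_fun setT f /\ (\int[mu]_t (f t)%:E = (P.[T] - P.[0])%:E)%E.
Proof.
move=> T0 fE QP.
have fE' : f = (fun t => Q.[t] * \1_(`[0, T]%classic) t).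
  apply/funext => t; rewrite fE indicE; case: ifPn => tT.
    by rewrite mem_set ?mulr1//= in_itv.
  by rewrite memNset ?mulr0//= in_itv; exact/negP.
split.
  rewrite fE'; apply: measurable_funM; last first.
    by apply: measurable_indic; exact: measurable_itv.
  by apply: continuous_measurable_fun; exact: continuous_horner.
rewrite -integral_deriv_poly// [RHS]integral_mkcond; apply: eq_integral => t _.
rewrite patchE fE; case: ifPn => tT; first by rewrite mem_set ?QP//= in_itv.
by rewrite memNset//= in_itv; exact/negP.
Qed.

Lemma integral_cone_profile (v T : R) m : 0 < T ->
  measurable_fun setT (cone_profile v T m) /\
  (\int[mu]_t (cone_profile v T m t)%:E = (v * T / m.+1%:R)%:E)%E.
Proof.
move=> T0; have Tn0 : T != 0 by rewrite gt_eqF.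
pose u : {poly R} := 1 - T^-1 *: 'X.
have ut t : u.[t] = 1 - t / T by rewrite /u !hornerE mulrC.
have u't t : u^`().[t] = - T^-1.
  by rewrite /u derivB derivC sub0r derivZ derivX hornerN hornerZ hornerC mulr1.
have mn0 : m.+1%:R != 0 :> R by rewrite pnatr_eq0.
have [] := @integral_poly_itv ((- (v * T / m.+1%:R)) *: u ^+ m.+1) (v *: u ^+ m)
  T (cone_profile v T m) T0.
- by move=> t; rewrite /cone_profile hornerZ horner_exp ut.
- move=> t; rewrite derivZ deriv_exp !hornerZ hornerMn hornerM !horner_exp ut u't /=.
  by rewrite -[(_ * _) *+ _]mulr_natr; move: (m.+1%:R) mn0 => c cn0; field; rewrite Tn0 cn0.
- move=> mf ->; split => //; congr EFin; rewrite !hornerZ !horner_exp !ut.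
  by rewrite divff// subrr mul0r subr0 expr1n expr0n /= mulr0 mulr1 sub0r opprK.
Qed.

Lemma integral_id_cone_profile (v T : R) m : 0 < T ->
  (\int[mu]_t (t * cone_profile v T m t)%:E = (v * T ^+ 2 / (m.+1%:R * m.+2%:R))%:E)%E.
Proof.
move=> T0; have Tn0 : T != 0 by rewrite gt_eqF.
pose u : {poly R} := 1 - T^-1 *: 'X.
have ut t : u.[t] = 1 - t / T by rewrite /u !hornerE mulrC.
have u't t : u^`().[t] = - T^-1.
  by rewrite /u derivB derivC sub0r derivZ derivX hornerN hornerZ hornerC mulr1.
have mn0 : m.+1%:R != 0 :> R by rewrite pnatr_eq0.
have mn1 : m.+2%:R != 0 :> R by rewrite pnatr_eq0.
(* With [u = 1 - t / T] one has [t = T (1 - u)], so the integrand is [v T (u ^ m - u ^ (m + 1))];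
   this is its antiderivative in powers of [u]. *)
have [] := @integral_poly_itv ((v * T ^+ 2 / m.+2%:R) *: u ^+ m.+2 -
    (v * T ^+ 2 / m.+1%:R) *: u ^+ m.+1) (v *: ('X * u ^+ m))
  T (fun t => t * cone_profile v T m t) T0.
- move=> t; rewrite /cone_profile hornerZ hornerM hornerX horner_exp ut.
  by case: ifP => _; rewrite ?mulr0//; ring.
- move=> t; rewrite derivB !derivZ !deriv_exp hornerZ hornerM hornerX horner_exp ut.
  rewrite hornerD hornerN !hornerZ !hornerMn !hornerM !horner_exp ut u't /= (exprS (1 - t / T)).
  rewrite -[(_ * _) *+ m.+2]mulr_natr -[(_ * _) *+ m.+1]mulr_natr; move: (m.+1%:R) (m.+2%:R) mn0 mn1 => c d cn0 dn0.
  by field; rewrite Tn0 cn0 dn0.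
- move=> mf ->; congr EFin; rewrite !hornerD !hornerN !hornerZ !horner_exp !ut.
  rewrite divff// subrr mul0r subr0 !expr1n !expr0n /=.
  rewrite -[m.+2%:R]natr1 in mn1 *; move: (m.+1%:R) mn0 mn1 => c cn0 dn0.
  by field; rewrite cn0 dn0.
Qed.

(* Both sides of the pointwise hypothesis say that [phi - psi] changes sign only
   once, from nonnegative to nonpositive, at [t0]. *)
Lemma first_moment_le (phi : R -> R) (v T t0 I : R) m :
  measurable_fun setT phi -> (forall t, 0 <= phi t) -> (forall t, t < 0 -> phi t = 0) ->
  0 <= v -> 0 < T -> 0 <= t0 -> (\int[mu]_t (phi t)%:E = I%:E)%E ->
  I <= v * T / m.+1%:R ->
  (forall t, t * phi t + t0 * cone_profile v T m t <=
             t * cone_profile v T m t + t0 * phi t) ->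
  (\int[mu]_t (t * phi t)%:E <= (v * T ^+ 2 / (m.+1%:R * m.+2%:R))%:E)%E.
Proof.
move=> mphi phi0 phineg v0 T0 t00 intphi IT h.
have [mpsi intpsi] := integral_cone_profile v m T0.
set psi := cone_profile v T m in h mpsi intpsi *.
have psi0 t : 0 <= psi t by exact: cone_profile_ge0.
have psineg t : t < 0 -> psi t = 0.
  by move=> t0'; rewrite /psi /cone_profile leNgt t0'.
have tpos (f : R -> R) : (forall t, 0 <= f t) -> (forall t, t < 0 -> f t = 0) ->
    forall t, 0 <= t * f t.
  move=> f0 fneg t; have [tn|tp] := ltP t 0; first by rewrite fneg// mulr0.
  exact: mulr_ge0.
have mE (f : R -> R) : measurable_fun setT f -> measurable_fun setT (fun t : R => (f t)%:E).
  by move=> mf; apply/measurable_EFinP.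
have mt (f : R -> R) : measurable_fun setT f -> measurable_fun setT (fun t : R => (t * f t)%:E).
  by move=> mf; apply: mE; apply: measurable_funM => //; exact: measurable_id.
have intc (f : R -> R) J : measurable_fun setT f -> (forall t, 0 <= f t) ->
    (\int[mu]_t (f t)%:E = J%:E)%E -> (\int[mu]_t (t0 * f t)%:E = (t0 * J)%:E)%E.
  move=> mf f0 fJ; under eq_integral do rewrite EFinM.
  rewrite ge0_integralZl ?lee_fin//; [by rewrite fJ|exact: mE|by move=> t _; rewrite lee_fin].
have mc (f : R -> R) : measurable_fun setT f -> measurable_fun setT (fun t : R => (t0 * f t)%:E).
  by move=> mf; apply: mE; apply: measurable_funM => //; exact: measurable_cst.
(* The pointwise hypothesis is integrated without subtraction, as the first moment of [phi] is not
   yet known to be finite; only a finite multiple of [t0] gets cancelled at the end. *)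
have H : (\int[mu]_t (t * phi t)%:E + (t0 * (v * T / m.+1%:R))%:E <=
    (v * T ^+ 2 / (m.+1%:R * m.+2%:R))%:E + (t0 * I)%:E)%E.
  rewrite -(intc psi)// -(intc phi _ mphi phi0 intphi) -integral_id_cone_profile//.
  rewrite -!ge0_integralD//; try by
    (exact: mt || exact: mc || (move=> t _; rewrite lee_fin; exact: tpos) ||
     (move=> t _; rewrite lee_fin mulr_ge0)).
  apply: ge0_le_integral => //.
  - by move=> t _; rewrite adde_ge0// lee_fin; [exact: tpos|rewrite mulr_ge0].
  - by apply: emeasurable_funD; [exact: mt|exact: mc].
  - by apply: emeasurable_funD; [exact: mt|exact: mc].
  - by move=> t _; rewrite -!EFinD lee_fin.
have {}H : (\int[mu]_t (t * phi t)%:E + (t0 * (v * T / m.+1%:R))%:E <=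
    (v * T ^+ 2 / (m.+1%:R * m.+2%:R))%:E + (t0 * (v * T / m.+1%:R))%:E)%E.
  by apply: le_trans H _; rewrite leeD2l// lee_fin ler_wpM2l.
by move: H; rewrite leeD2rE.
Qed.

End Crossing.

(** * The second-moment inequality for concave fibre lengths *)

Section Berwald.
Context {R : realType}.
Notation mu := (@lebesgue_measure R).

(** Points are [(y, s, t)] with [0 <= t <= s <= vol (sec K y)]: the fibre over [y] has area half the
    squared fibre volume, and the slice at [s] is a superlevel set times [[0, s]]. *)
Definition wedge m p (K : set 'rV[R]_(m + p)) : set 'rV[R]_(m + (1 + 1)) :=
  [set x | superlevel K 1 (lsubmx (rsubmx x) 0 0) (lsubmx x) /\
    0 <= rsubmx (rsubmx x) 0 0 <= lsubmx (rsubmx x) 0 0].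

Lemma compact_wedge m p (K : set 'rV[R]_(m + p)) : compact K -> compact (wedge K).
Proof.
move=> cK; have cH := @compact_hypograph R m p K 1 ltr01 cK.
have [V V0 HV] := vol_sec_bounded cK.
have := compact_setX cH (@segment_compact R 0 V).
pose g (x : 'rV[R]_(m + 1) * R) := row_mx (lsubmx x.1) (row_mx (rsubmx x.1) (cst1 x.2)).
have c1 (j : 'I_(m + 1)) : continuous (fun x : 'rV[R]_(m + 1) * R => x.1 0 j).
  move=> x; apply: (@continuous_comp _ _ _ fst (fun y : 'rV[R]_(m + 1) => y 0 j));
    [exact: cvg_fst|exact: coord_continuous].
have cg : continuous g.
  apply: rV_continuous => i; rewrite /g; case: (split_ordP i) => j ->.
    by under eq_fun do rewrite row_mxEl mxE; exact: c1.
  case: (split_ordP j) => l ->.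
    by under eq_fun do rewrite row_mxEr row_mxEl mxE; exact: c1.
  by under eq_fun do rewrite !row_mxEr mxE; move=> x; exact: cvg_snd.
pose C := [set x : 'rV[R]_(m + 1) * R | 0 <= rsubmx x.1 0 0 - x.2].
have clC : closed C.
  apply: (@preimage_closed _ _ (fun x : 'rV[R]_(m + 1) * R => rsubmx x.1 0 0 - x.2)
    [set t : R | 0 <= t]); last exact: closed_ge.
  have cr : continuous (fun x : 'rV[R]_(m + 1) * R => rsubmx x.1 0 0).
    by under eq_fun do rewrite mxE; exact: c1.
  by move=> x _; apply: cvgB; [exact: cr|exact: cvg_snd].
move=> /compact_closedI /(_ clC) cI.
have := @continuous_compact _ _ g _ (continuous_subspaceT cg) cI.
congr (compact _); apply/seteqP; split.
  move=> x [[h t] [[/= Hh tV] ts] <-]; move: tV ts.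
  rewrite in_itv /= => /andP[t0 tV]; rewrite /C /= subr_ge0 => ts.
  rewrite /wedge /g /= !(row_mxKl, row_mxKr) [cst1 t 0 0]mxE; split => //.
  by rewrite t0.
move=> x [[Px s0 sv] /andP[t0 ts]]; exists (row_mx (lsubmx x) (lsubmx (rsubmx x)), rsubmx (rsubmx x) 0 0).
  split; first split => /=.
  - by rewrite /hypograph /= row_mxKl row_mxKr.
  - by rewrite in_itv /= t0 (le_trans ts)//; move: sv; rewrite mul1r => /le_trans; apply.
  - by rewrite /C /= row_mxKr subr_ge0.
by rewrite /g /= row_mxKl row_mxKr rV1_cst1 !hsubmxK.
Qed.

Definition square (f : R) : set 'rV[R]_(1 + 1) :=
  [set z | 0 <= lsubmx z 0 0 <= f /\ 0 <= rsubmx z 0 0 <= f].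

Definition triangle (f : R) : set 'rV[R]_(1 + 1) :=
  [set z | 0 <= lsubmx z 0 0 <= f /\ 0 <= rsubmx z 0 0 <= lsubmx z 0 0].

Lemma compact_square f : compact (square f).
Proof.
have := @rV_compact R (1 + 1) (fun=> `[0, f]%classic) (fun=> @segment_compact R 0 f).
congr (compact _); apply/seteqP; split => z /=.
  move=> h; have := h (lshift 1 0); have := h (rshift 1 0).
  by rewrite /square /= !mxE !in_itv.
rewrite /square /= !mxE => -[h1 h2] i; case: (split_ordP i) => j ->;
  by rewrite (ord1 j) in_itv.
Qed.

Lemma vol_square_ge f : 0 <= f -> f ^+ 2 <= vol (square f).
Proof.
move=> f0; have cI := @compact_itv_rV R 0 f.
have := @vol_fubini_ge R 1 0 0 (square f) (itv_rV 0 f) (itv_rV 0 f) f 0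
  (@compact_square f) cI cI f0 (lexx _).
rewrite vol_itv_rV// subr0 mul0r addr0 -expr2; apply => s; rewrite mul0r addr0.
have [h|h] := boolP (0 <= s <= f).
  rewrite (_ : sec (square f) (cst1 s) = itv_rV 0 f).
    rewrite vol_itv_rV// subr0 vol_dim0 ?mulr1//; exists 0.
    by rewrite /sec /itv_rV /= cst1_row_mxE.
  apply/seteqP; split => z; rewrite /sec /square /itv_rV /= row_mxKl row_mxKr !mxE.
    by case.
  by [].
rewrite (_ : sec (itv_rV 0 f : set 'rV[R]_(1 + 0)) (cst1 s) = set0).
  by rewrite vol0 mulr0 vol_ge0.
by apply/seteqP; split => // z; rewrite /sec /itv_rV /= cst1_row_mxE (negbTE h).
Qed.

(** The square is the union of the triangle and its mirror image in the diagonal. *)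
Lemma vol_triangle_ge f : 0 <= f -> f ^+ 2 <= 2 * vol (triangle f).
Proof.
move=> f0; have cT : coverable (triangle f).
  apply: coverableS (compact_coverable (@compact_square f)) => z [/andP[s0 sf] /andP[t0 ts]].
  by rewrite /square /= s0 sf t0 (le_trans ts).
have bs : bijective (@swap_ord 1 1) by exists (@swap_ord 1 1) => i; rewrite swap_ordK.
pose T' := [set \row_i (x : 'rV[R]_(1 + 1)) 0 (swap_ord i) | x in triangle f].
have vT' := vol_permute bs cT.
have T'E : T' = [set swap_row x | x in triangle f].
  apply: eq_imagel => x _; apply/rowP => i; rewrite !mxE /swap_ord.
  by case: (fintype.split i) => j; rewrite mxE.
have cT' : coverable T'.
  apply: coverableS (compact_coverable (@compact_square f)).
  rewrite T'E => _ [z [/andP[s0 sf] /andP[t0 ts]] <-].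
  by rewrite /square /swap_row /= row_mxKl row_mxKr s0 sf t0 (le_trans ts).
apply: le_trans (vol_square_ge f0) _.
apply: le_trans (le_vol (_ : _ `<=` triangle f `|` T') (coverableU cT cT')) _.
  move=> z [/andP[s0 sf] /andP[t0 tf]].
  have [ts|st] := leP (rsubmx z 0 0) (lsubmx z 0 0).
    by left; rewrite /triangle /= s0 sf t0.
  right; rewrite T'E; exists (swap_row z); last exact: swap_rowK.
  by rewrite /triangle /swap_row /= row_mxKl row_mxKr t0 tf s0 ltW.
by apply: le_trans (volU cT cT') _; rewrite mulr2n mulrDl mul1r lerD2l.
Qed.

Lemma vol_sec_wedge_ge m p (K : set 'rV[R]_(m + p)) y : compact K ->
  vol (sec K y) ^+ 2 <= 2 * vol (sec (wedge K) y).
Proof.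
move=> cK; have [Py|nPy] := pselect (shadow K y); last first.
  rewrite (_ : sec K y = set0) ?vol0 ?expr0n ?mulr_ge0 ?vol_ge0//.
  by apply/seteqP; split => // z Kz; apply: nPy; exists z.
rewrite (_ : sec (wedge K) y = triangle (vol (sec K y))).
  by apply: vol_triangle_ge; exact: vol_ge0.
apply/seteqP; split => z; rewrite /sec /wedge /superlevel /triangle /= row_mxKl row_mxKr mul1r.
  by case=> [[_ -> ->]].
by case=> [/andP[-> ->]].
Qed.

Lemma vol_wedge_le m p (K : set 'rV[R]_(m + p)) : compact K ->
  ((vol (wedge K))%:E <= \int[mu]_t (t * vol (superlevel K 1 t))%:E)%E.
Proof.
move=> cK; have cW := compact_wedge cK.
pose W : set 'rV[R]_(1 + (1 + m)) := [set swap_row x | x in wedge K].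
have cW' : compact W by apply: compact_image => //; exact: swap_row_continuous.
have mphi : measurable_fun setT (fun t => vol (superlevel K 1 t)).
  have := measurable_vol_sec (@compact_levels R m p K 1 ltr01 cK).
  by under eq_fun do rewrite sec_levels.
have -> : vol (wedge K) = vol W by exact: (esym (vol_swap cW)).
rewrite vol_fubini//; apply: ge0_le_integral => //.
- by move=> t _; rewrite lee_fin vol_ge0.
- exact: measurable_EFin_vol_sec.
- by apply/measurable_EFinP; apply: measurable_funM => //; exact: measurable_id.
move=> t _; rewrite lee_fin.
have secW (x : 'rV[R]_(1 + m)) : sec W (cst1 t) x ->
    superlevel K 1 t (rsubmx x) /\ 0 <= x 0 0 <= t.
  rewrite /sec /= -[x in row_mx _ x]row_mx_cst1.
  rewrite [row_mx (cst1 t) _](row_mx1A t (cst1 (x 0 0)) (rsubmx x)) => -[w Ww e].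
  have : swap_row (swap_row w) =
      row_mx (rsubmx x) (row_mx (cst1 t) (cst1 (x 0 0))).
    by rewrite e /swap_row row_mxKl row_mxKr.
  rewrite swap_rowK => wE; move: Ww; rewrite wE /wedge /= !(row_mxKl, row_mxKr).
  by rewrite ![cst1 _ 0 0]mxE.
have [t0|t0] := leP 0 t; last first.
  rewrite (_ : sec W (cst1 t) = set0).
    rewrite vol0 (_ : superlevel K 1 t = set0) ?vol0 ?mulr0//.
    by apply/seteqP; split => // y [_]; rewrite leNgt t0.
  by apply/seteqP; split => // x /secW[[_]]; rewrite leNgt t0.
have [_] := @vol_cylinder R m (superlevel K 1 t) (sec W (cst1 t)) 0 t t0
  (fun x Hx => conj (secW x Hx).2 (secW x Hx).1)
  (compact_coverable (@compact_superlevel R m p K 1 t ltr01 cK)).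
by rewrite subr0.
Qed.

Lemma sec_vol_concave m (K : set 'rV[R]_(m + 1)) y1 y2 l : compact K -> is_convex K ->
  0 <= l <= 1 -> shadow K y1 -> shadow K y2 ->
  l * vol (sec K y1) + (1 - l) * vol (sec K y2) <= vol (sec K (l *: y1 + (1 - l) *: y2)).
Proof.
move=> cK vK l01 P1 P2; have /andP[l0 l1] := l01.
apply: brunn_minkowski_dim1 => //; try exact: compact_sec.
- exact: is_convex_sec.
- by rewrite subr_ge0.
- by move=> u w; exact: convex_sec.
Qed.

Lemma superlevel0 m p (K : set 'rV[R]_(m + p)) c : superlevel K c 0 = shadow K.
Proof.
by apply/seteqP; split => y; [case|move=> Py; split => //; rewrite mulr0 vol_ge0].
Qed.

(* Brunn-Minkowski for the superlevel sets of the concave function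
   [y |-> vol (sec K y)] on [shadow K]: once the profile of superlevel volumes
   dominates that of the cone, it did so at all lower heights. *)
Lemma superlevel_dominates m (K : set 'rV[R]_(m + 1)) (T s t : R) :
  (0 < m)%N -> compact K -> is_convex K -> 0 < vol (shadow K) -> 0 < T ->
  0 <= s < t -> 0 < vol (superlevel K 1 t) ->
  cone_profile (vol (shadow K)) T m t <= vol (superlevel K 1 t) ->
  0 < vol (superlevel K 1 s) /\
  cone_profile (vol (shadow K)) T m s <= vol (superlevel K 1 s).
Proof.
move=> m0 cK vK v0 T0 /andP[s0 st] vt psit; have t0 : 0 < t by exact: le_lt_trans st.
have root (a : R) : 0 < a -> exists2 r, 0 < r & r ^+ m = a.
  move=> a0; have [r r0 rm] := nth_root_exists m0 (ltW a0); exists r => //.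
  rewrite lt_neqAle r0 andbT; apply: contraTneq a0 => r00.
  by rewrite -rm -r00 expr0n gtn_eqF// ltxx.
have [x x0 xm] := root _ v0; have [y y0 ym] := root _ vt.
(* By concavity, combining the base with weight [1 - l] and the superlevel set at [t] with weight
   [l] lands at height at least [l t = s]. *)
pose l := s / t.
have l0 : 0 <= l by rewrite divr_ge0// ltW.
have l1 : l < 1 by rewrite ltr_pdivrMr// mul1r.
have ls : l * t = s by rewrite divfK// gt_eqF.
have nonempty (A : set 'rV[R]_m) : 0 < vol A -> A !=set0.
  by move=> vA; apply/set0P; apply: contraTneq vA => ->; rewrite vol0 ltxx.
have convL : is_convex (superlevel K 1 s).
  apply: convex_superlevel => // y1 y2 k _ k01; rewrite mul1r => h1 h2 P1 P2.
  apply: le_trans (sec_vol_concave cK vK k01 P1 P2); have /andP[k0 k1] := k01.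
  rewrite (_ : s = k * s + (1 - k) * s); last by ring.
  by apply: lerD; apply: ler_wpM2l; rewrite ?subr_ge0.
have bm : ((1 - l) * x + l * y) ^+ m <= vol (superlevel K 1 s).
  apply: (@brunn_minkowski R m (shadow K) (superlevel K 1 t)) => //.
  - exact: compact_shadow.
  - exact: compact_superlevel.
  - exact: compact_superlevel.
  - by rewrite subr_ge0 ltW.
  - by rewrite subrK.
  - exact: nonempty.
  - exact: nonempty.
  - move=> u w Pu [Pw _]; rewrite mul1r => tw.
    have l01 : 0 <= 1 - l <= 1 by rewrite subr_ge0 (ltW l1) gerBl.
    have le := sec_vol_concave cK vK l01 Pu Pw.
    move: le; rewrite (_ : 1 - (1 - l) = l); last by ring.
    move=> le; split => //.
      case: Pu => z1 Kz1; case: Pw => z2 Kz2; exists ((1 - l) *: z1 + l *: z2).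
      have := convex_sec vK l01 Kz1 Kz2.
      by rewrite (_ : 1 - (1 - l) = l)//; ring.
    rewrite mul1r -ls; apply: le_trans le.
    rewrite -[leLHS]add0r lerD// ?ler_wpM2l// mulr_ge0 ?vol_ge0//.
    by rewrite subr_ge0 ltW.
  - by rewrite xm.
  - by rewrite ym.
have w0 : 0 < (1 - l) * x + l * y.
  by apply: ltr_pwDl; [rewrite mulr_gt0// subr_gt0|rewrite mulr_ge0// ltW].
split; first by apply: lt_le_trans bm; rewrite exprn_gt0.
rewrite /cone_profile; case: ifPn => [/andP[_ sT]|_]; last exact: vol_ge0.
apply: le_trans bm; rewrite -xm -exprMn; apply: lerXn2r.
- by rewrite nnegrE mulr_ge0 ?(ltW x0)// subr_ge0 ler_pdivrMr// mul1r.
- by rewrite nnegrE ltW.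
(* This is the [m]-th root of [psit]; beyond [T] the left side is nonpositive. *)
have xy : x * (1 - t / T) <= y.
  have [tT|Tt] := leP t T; last first.
    apply: (@le_trans _ _ 0); last exact: ltW.
    by rewrite pmulr_rle0// subr_le0 ler_pdivlMr// mul1r ltW.
  have tT0 : 0 <= 1 - t / T by rewrite subr_ge0 ler_pdivrMr// mul1r.
  move: psit; rewrite /cone_profile (ltW t0) tT /= -xm -ym -exprMn.
  by rewrite ler_pXn2r// nnegrE ?mulr_ge0// ltW.
apply: (@le_trans _ _ ((1 - l) * x + l * (x * (1 - t / T)))).
  by rewrite -ls le_eqVlt; apply/orP; left; apply/eqP; ring.
by rewrite lerD2l ler_wpM2l.
Qed.

(** Bounding [vol K] by the volume of the cone, rather than equating the two, leaves room for a
    positive [T] even if [vol K] vanishes. *)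
Lemma vol_wedge_cone m (K : set 'rV[R]_(m + 1)) (T : R) :
  (0 < m)%N -> compact K -> is_convex K -> 0 < vol (shadow K) -> 0 < T ->
  vol K <= vol (shadow K) * T / m.+1%:R ->
  vol (wedge K) <= vol (shadow K) * T ^+ 2 / (m.+1%:R * m.+2%:R).
Proof.
move=> m0 cK vK v0 T0 KT.
pose phi t := vol (superlevel K 1 t); pose psi := cone_profile (vol (shadow K)) T m.
(* Positivity of [phi t] is what bounds [S]: above [T] the profile is 0 and [psi t <= phi t] holds
   for free. *)
pose S := [set t : R | [/\ 0 <= t, 0 < phi t & psi t <= phi t]].
have S0 : S 0.
  split => //; rewrite /phi superlevel0//.
  by rewrite /psi /cone_profile lexx (ltW T0) /= mul0r subr0 expr1n mulr1.
have [V V0 HV] := vol_sec_bounded cK.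
have ubS : ubound S V.
  move=> t [t0 pt _]; rewrite leNgt; apply/negP => Vt; move: pt.
  rewrite /phi superlevel_eq0 ?vol0 ?ltxx// => y; rewrite mul1r.
  exact: le_lt_trans (HV y) Vt.
have supS : has_sup S by split; [exists 0|exists V].
have t00 : 0 <= sup S by apply: ub_le_sup => //; exists V.
rewrite -lee_fin; apply: le_trans (vol_wedge_le cK) _.
apply: (@first_moment_le R phi (vol (shadow K)) T (sup S) (vol K)) => //.
- have := measurable_vol_sec (@compact_levels R m 1 K 1 ltr01 cK).
  by under eq_fun do rewrite sec_levels.
- by move=> t; exact: vol_ge0.
- move=> t t0; rewrite /phi (_ : superlevel K 1 t = set0) ?vol0//.
  by apply/seteqP; split => // y [_]; rewrite leNgt t0.
- exact: ltW.
- have := vol_levels (@ltr01 R) cK; rewrite divr1 => <-.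
  rewrite vol_fubini; last exact: compact_levels.
  by apply: eq_integral => t _; rewrite sec_levels.
move=> t; rewrite -/psi -subr_ge0.
(* Below [sup S], [superlevel_dominates] carries the domination down from a higher point of [S];
   above it, [phi t > psi t >= 0] would put [t] into [S]. The two factors thus have the same
   sign. *)
rewrite (_ : _ - _ = (sup S - t) * (phi t - psi t)); last by ring.
have [tn|tp] := ltP t 0.
  rewrite /phi (_ : superlevel K 1 t = set0); last first.
    by apply/seteqP; split => // y [_]; rewrite leNgt tn.
  have -> : psi t = 0 by rewrite /psi /cone_profile leNgt tn.
  by rewrite vol0 subrr mulr0.
have [ts|st|->] := ltgtP t (sup S); last by rewrite subrr mul0r.
- have [t' [t'0 pt' psit'] tt'] := sup_gt (ex_intro _ 0 S0) ts.
  have tlt : 0 <= t < t' by rewrite tp.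
  have [_ h] := superlevel_dominates m0 cK vK v0 T0 tlt pt' psit'.
  by rewrite mulr_ge0// subr_ge0 ?(ltW ts).
- have nS : ~ S t by move=> St; move: st; rewrite ltNge ub_le_sup//; exists V.
  rewrite -mulrNN !opprB mulr_ge0// ?subr_ge0 ?(ltW st)//.
  rewrite leNgt; apply/negP => h; apply: nS; split => //; last exact: ltW.
  by apply: le_lt_trans h; apply: cone_profile_ge0 => //; exact: ltW.
Qed.

End Berwald.

(** * From planar fibres to the product of two projections *)

Section LocalLoomisWhitney.
Context {R : realType}.

Lemma vol_convex_rV1 (X : set 'rV[R]_1) : compact X -> is_convex X -> X !=set0 ->
  exists b1 b2, [/\ b1 <= b2, b2 - b1 <= vol X & forall x, X x -> b1 <= x 0 0 <= b2].
Proof.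
move=> cX vX X0; have [x1 [x2 [X1 X2 Xb]]] := rV1_endpoints cX X0.
have x12 : x1 0 0 <= x2 0 0 by have /andP[] := Xb _ X2.
exists (x1 0 0), (x2 0 0); split => //; rewrite -vol_itv_rV//.
apply: le_vol; last exact: compact_coverable.
move=> x /andP[h1 h2]; have [e|ne] := eqVneq (x1 0 0) (x2 0 0).
  rewrite (_ : x = x1)//; apply/rowP => i; rewrite !ord1; apply: le_anti.
  by rewrite h1 e h2.
have d0 : 0 < x2 0 0 - x1 0 0 by rewrite subr_gt0 lt_neqAle ne.
pose t := (x2 0 0 - x 0 0) / (x2 0 0 - x1 0 0).
have t01 : 0 <= t <= 1.
  by rewrite /t divr_ge0 ?subr_ge0//= ler_pdivrMr// mul1r lerB.
rewrite (_ : x = t *: x1 + (1 - t) *: x2); first exact: vX.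
by apply/rowP => i; rewrite !mxE !ord1 /t; field; rewrite gt_eqF.
Qed.

(* A planar set is contained in the parallelogram over its two (unequally
   directed) projections. *)
Lemma vol_planar_le (A : set 'rV[R]_(1 + 1)) (X Y : set 'rV[R]_1) (c s : R) :
  0 < s -> compact A -> compact X -> compact Y -> is_convex Y ->
  (forall z, A z -> X (lsubmx z) /\ Y (cst1 (s * rsubmx z 0 0 - c * lsubmx z 0 0))) ->
  s * vol A <= vol X * vol Y.
Proof.
move=> s0 cA cX cY vY AXY.
have [Y0|nY] := pselect (Y !=set0); last first.
  have -> : A = set0.
    by apply/seteqP; split => // z /AXY[_ Yz]; apply: nY; eexists; exact: Yz.
  by rewrite vol0 mulr0 mulr_ge0// vol_ge0.
have [b1 [b2 [b12 vb Yb]]] := vol_convex_rV1 cY vY Y0.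
have g0 : 0 <= vol Y / s by rewrite divr_ge0 ?vol_ge0// ltW.
(* On the slice at [t], [s w - c t] stays in an interval of length at most [vol Y], so [w] ranges
   over a length [vol Y / s]. Sections of [X] live in dimension 0 and act as its indicator
   function. *)
have := @vol_fubini_le R 1 0 0 A X X (vol Y / s) 0 cA cX cX g0 (lexx _).
rewrite mul0r addr0 => H; rewrite -ler_pdivlMl// [_ * (_ * _)]mulrC -mulrA mulrC.
apply: H => t; rewrite mul0r addr0.
have [[z Az]|nA] := pselect (sec A (cst1 t) !=set0); last first.
  have -> : sec A (cst1 t) = set0.
    by apply/seteqP; split => // z Az; apply: nA; exists z.
  by rewrite vol0 mulr_ge0// vol_ge0.
rewrite (@vol_dim0 _ (@sec R 1 0 X (cst1 t))) ?mulr1; last first.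
  exists 0; have [+ _] := AXY _ Az; rewrite row_mxKl /sec /=.
  by congr X; apply/rowP => i; rewrite ord1 (cst1_row_mxE t) mxE.
apply: (@le_trans _ _ ((b2 + c * t) / s - (b1 + c * t) / s)); last first.
  by rewrite -mulrBl ler_pM2r ?invr_gt0//; apply: le_trans vb; rewrite opprD addrACA subrr addr0.
have le12 : (b1 + c * t) / s <= (b2 + c * t) / s by rewrite ler_pM2r ?invr_gt0// lerD2r.
rewrite -vol_itv_rV//; apply: le_vol; last exact/compact_coverable/compact_itv_rV.
move=> w Aw; have [_ /Yb] := AXY _ Aw; rewrite row_mxKl row_mxKr !mxE => /andP[h1 h2].
by rewrite /itv_rV /= ler_pdivrMr// ler_pdivlMr//; apply/andP; split; lra.
Qed.

(** Here [c] and [s] stand for the cosine and sine of the angle between [u] and [v]. The fibre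
    coordinates of [K] will be those along [wu] and [u], and the linear form is then the coordinate
    along [wv]. *)
Lemma vol_fibres_le m (K : set 'rV[R]_(m + (1 + 1))) (M N : set 'rV[R]_(m + 1)) (c s : R) :
  (0 < m)%N -> 0 < s -> compact K -> compact M -> compact N ->
  is_convex M -> is_convex N -> shadow M = shadow N ->
  (forall y z, sec K y z -> sec M y (lsubmx z) /\
     sec N y (cst1 (s * rsubmx z 0 0 - c * lsubmx z 0 0))) ->
  m.+2%:R / (2 * m.+1%:R) * s * vol K * vol (shadow M) <= vol M * vol N.
Proof.
move=> m0 s0 cK cM cN vM vN MN KMN.
have [L0|Ln0] := eqVneq (vol (shadow M)) 0.
  by rewrite L0 mulr0 mulr_ge0// vol_ge0.
have L0 : 0 < vol (shadow M) by rewrite lt_def Ln0 vol_ge0.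
set L := vol (shadow M) in L0 *.
have m1 : 0 < m.+1%:R :> R by rewrite ltr0n.
have m2 : 0 < m.+2%:R :> R by rewrite ltr0n.
have vW (A : set 'rV[R]_(m + 1)) a : compact A -> is_convex A -> vol (shadow A) = L ->
    vol A < a -> vol (wedge A) <= m.+1%:R * a ^+ 2 / (m.+2%:R * L).
  move=> cA vA LA Aa; have a0 : 0 < a by exact: le_lt_trans (vol_ge0 _) Aa.
  (* This height gives the cone over a base of volume [L] the volume [L T / (m + 1) = a]. *)
  have T0 : 0 < m.+1%:R * a / L by rewrite divr_gt0// mulr_gt0.
  have := @vol_wedge_cone R m A (m.+1%:R * a / L) m0 cA vA; rewrite LA => /(_ L0 T0).
  have -> : L * (m.+1%:R * a / L) / m.+1%:R = a by field; rewrite !gt_eqF.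
  move=> /(_ (ltW Aa)) /le_trans; apply.
  by rewrite le_eqVlt; apply/orP; left; apply/eqP; field; rewrite !gt_eqF.
(* Strict upper bounds stand in for the volumes, which may vanish, in the weights [b / a] and
   [a / b]; the slack is removed at the end. *)
have main a b : vol M < a -> vol N < b ->
    m.+2%:R / (2 * m.+1%:R) * s * vol K * L <= a * b.
  move=> Ma Nb.
  have a0 : 0 < a by exact: le_lt_trans (vol_ge0 _) Ma.
  have b0 : 0 < b by exact: le_lt_trans (vol_ge0 _) Nb.
  have WM := vW M a cM vM erefl Ma.
  have WN := vW N b cN vN (congr1 (@vol R m) (esym MN)) Nb.
  have := @vol_sec_le R m (1 + 1) (1 + 1) (1 + 1) K (wedge M) (wedge N)
    (b / a / s) (a / b / s) cK (compact_wedge cM) (compact_wedge cN).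
  have p1 : 0 <= b / a / s by rewrite !divr_ge0// ltW.
  have p2 : 0 <= a / b / s by rewrite !divr_ge0// ltW.
  move=> /(_ p1 p2) H.
  have {}H : vol K <= b / a / s * vol (wedge M) + a / b / s * vol (wedge N).
    apply: H => y.
    have hf := @vol_sec_wedge_ge R m 1 M y cM; have hg := @vol_sec_wedge_ge R m 1 N y cN.
    have := @vol_planar_le (sec K y) (sec M y) (sec N y) c s s0
      (@compact_sec R m (1 + 1) K y cK) (@compact_sec R m 1 M y cM) (@compact_sec R m 1 N y cN)
      (@is_convex_sec R m 1 N y vN) (KMN y).
    set k := vol (sec K y); set f := vol (sec M y) in hf *; set g := vol (sec N y) in hg *.
    set wf := vol _ in hf *; set wg := vol _ in hg *.
    rewrite -ler_pdivlMl// => /le_trans; apply.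
    rewrite (_ : b / a / s * wf + a / b / s * wg = s^-1 * (b / a * wf + a / b * wg)).
      rewrite ler_pM2l ?invr_gt0//.
      (* AM-GM: f g <= (b/a f^2 + a/b g^2) / 2 *)
      have sq : 0 <= a * b * (f / a - g / b) ^+ 2.
        by rewrite mulr_ge0 ?sqr_ge0// ltW// mulr_gt0.
      have e : a * b * (f / a - g / b) ^+ 2 = b / a * f ^+ 2 + a / b * g ^+ 2 - 2 * (f * g).
        by field; rewrite !gt_eqF.
      have h1 : b / a * f ^+ 2 <= b / a * (2 * wf) by rewrite ler_wpM2l// divr_ge0// ltW.
      have h2 : a / b * g ^+ 2 <= a / b * (2 * wg) by rewrite ler_wpM2l// divr_ge0// ltW.
      by move: sq; rewrite e; lra.
    by ring.
  have {}H := le_trans H (lerD (ler_wpM2l p1 WM) (ler_wpM2l p2 WN)).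
  have q0 : 0 <= m.+2%:R / (2 * m.+1%:R) * s * L.
    by rewrite !mulr_ge0 ?invr_ge0 ?mulr_ge0// ltW.
  rewrite mulrAC; apply: le_trans (ler_wpM2l q0 H) _.
  rewrite le_eqVlt; apply/orP; left; apply/eqP; field.
  by rewrite !gt_eqF.
apply/ler_addgt0Pr => e e0; have S0 : 0 < vol M + vol N + 1 by rewrite ltr_pwDr// addr_ge0// vol_ge0.
(* As [d <= 1], replacing the volumes by [vol M + d] and [vol N + d] raises the product by at most
   [d (vol M + vol N + 1) <= e]. *)
pose d := Num.min 1 (e / (vol M + vol N + 1)).
have d0 : 0 < d by rewrite lt_min ltr01 divr_gt0.
have d1 : d <= 1 by rewrite ge_min lexx.
have de : d * (vol M + vol N + 1) <= e.
  by rewrite -ler_pdivlMr// /d ge_min lexx orbT.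
have := main (vol M + d) (vol N + d); rewrite !ltrDl => /(_ d0 d0) /le_trans; apply.
rewrite (_ : (vol M + d) * (vol N + d) = vol M * vol N + d * (vol M + vol N + d)); last by ring.
by rewrite lerD2l; apply: le_trans de; rewrite ler_wpM2l ?(ltW d0)// lerD2l.
Qed.

End LocalLoomisWhitney.

(** * Orthonormal frames and projections onto orthogonal complements *)

Section Frames.
Context {R : realType}.

Lemma vol_orthogonal k (Q : 'M[R]_k.+1) (A : set 'rV[R]_k.+1) : Q *m Q^T = 1%:M ->
  compact A -> vol [set x *m Q | x in A] <= vol A.
Proof.
move=> QQ cA; apply: vol_linear => //.
have : \det Q * \det Q = 1 by rewrite -{2}det_tr -det_mulmx QQ det1.
move=> dd; apply/eqP; rewrite -(eqrXn2 (n := 2)) ?normr_ge0 ?ler01//.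
by rewrite expr1n -normrX expr2 dd normr1.
Qed.

(** For orthonormal [E], the second hypothesis says that the rows of [G] lie in the row space of
    [E]. The change of coordinates [E *m G^T] is then orthogonal. *)
Lemma vol_frame_le k n (E G : 'M[R]_(k.+1, n)) (K : set 'rV[R]_n) :
  G *m G^T = 1%:M -> G *m E^T *m E = G -> compact K ->
  vol [set x *m G^T | x in K] <= vol [set x *m E^T | x in K].
Proof.
move=> GG GE cK; pose Q := E *m G^T.
have QQ : Q *m Q^T = 1%:M.
  by apply: mulmx1C; rewrite /Q trmx_mul trmxK mulmxA GE.
apply: le_trans (vol_orthogonal QQ (compact_mulmx (U := E^T) cK)).
apply: le_vol; last exact/compact_coverable/compact_mulmx/compact_mulmx.
move=> _ [x Kx <-]; exists (x *m E^T); first by exists x.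
by rewrite -mulmxA (_ : E^T *m Q = G^T)// -[in RHS]GE !trmx_mul trmxK.
Qed.

(** Stacking [u] on [E] gives a square matrix with orthonormal rows; its one-sided inverse is
    two-sided, which is the resolution of the identity. *)
Lemma frame_complete k (E : 'M[R]_(k, 1 + k)) (u : 'rV[R]_(1 + k)) :
  u *m u^T = 1%:M -> E *m E^T = 1%:M -> E *m u^T = 0 ->
  u^T *m u + E^T *m E = 1%:M.
Proof.
move=> uu EE Eu; have uE : u *m E^T = 0 by apply: trmx_inj; rewrite trmx_mul trmxK trmx0.
rewrite -mul_row_col -tr_col_mx; apply: mulmx1C.
by rewrite tr_col_mx mul_col_row uu EE Eu uE -scalar_mx_block.
Qed.

Lemma is_convex_mulmx n k (U : 'M[R]_(n, k)) (K : set 'rV[R]_n) : is_convex K ->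
  is_convex [set x *m U | x in K].
Proof.
move=> vK _ _ t [x Kx <-] [y Ky <-] t01; exists (t *: x + (1 - t) *: y).
  exact: vK.
by rewrite mulmxDl -!scalemxAl.
Qed.

Lemma shadow_mulmx n m p (B : 'M[R]_(n, m)) (C : 'M[R]_(n, p)) (K : set 'rV[R]_n) :
  shadow [set x *m row_mx B C | x in K] = [set x *m B | x in K].
Proof.
rewrite shadowE; apply/seteqP; split=> [_ [_ [x Kx <-] <-]|_ [x Kx <-]].
  by exists x => //; rewrite mul_mx_row row_mxKl.
by exists (x *m row_mx B C); [exists x|rewrite mul_mx_row row_mxKl].
Qed.

Lemma vol_swap_mulmx n m p (B : 'M[R]_(n, m)) (C : 'M[R]_(n, p)) (K : set 'rV[R]_n) :
  compact K -> vol [set x *m row_mx B C | x in K] = vol [set x *m row_mx C B | x in K].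
Proof.
move=> cK; rewrite -vol_swap; last exact: compact_mulmx.
congr vol; apply/seteqP; split=> [_ [_ [x Kx <-] <-]|_ [x Kx <-]].
  by exists x => //; rewrite !mul_mx_row /swap_row row_mxKl row_mxKr.
exists (x *m row_mx B C); first by exists x.
by rewrite !mul_mx_row /swap_row row_mxKl row_mxKr.
Qed.

(* Projecting along [u]: [x |-> (x B^T, x w^T)] is another orthonormal coordinate
   system on [u^perp]. *)
Lemma vol_projection_frame m (K : set 'rV[R]_m.+2) (u w : 'rV[R]_m.+2)
    (E : 'M[R]_(m.+1, m.+2)) (B : 'M[R]_(m, m.+2)) : compact K ->
  u *m u^T = 1%:M -> E *m E^T = 1%:M -> E *m u^T = 0 ->
  w *m w^T = 1%:M -> w *m u^T = 0 -> B *m B^T = 1%:M -> B *m u^T = 0 -> B *m w^T = 0 ->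
  vol [set x *m row_mx B^T w^T | x in K] <= vol [set x *m E^T | x in K].
Proof.
move=> cK uu EE Eu ww wu BB Bu Bw.
have wB : w *m B^T = 0 by apply: trmx_inj; rewrite trmx_mul trmxK trmx0.
have GG : col_mx w B *m (col_mx w B)^T = 1%:M.
  by rewrite tr_col_mx mul_col_row ww BB Bw wB -scalar_mx_block.
have GE : col_mx w B *m E^T *m E = col_mx w B.
  have /(congr1 (mulmx (col_mx w B))) := @frame_complete m.+1 E u uu EE Eu.
  by rewrite mulmx1 mulmxDr !mulmxA mul_col_mx wu Bu col_mx0 mul0mx add0r.
by rewrite vol_swap_mulmx// -tr_col_mx; exact: (@vol_frame_le m).
Qed.

Lemma local_loomis_whitney m (K : set 'rV[R]_m.+2) (u v : 'rV[R]_m.+2)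
    (Eu Ev : 'M[R]_(m.+1, m.+2)) (B : 'M[R]_(m, m.+2)) (c : R) :
  (0 < m)%N -> compact K -> is_convex K ->
  u *m u^T = 1%:M -> v *m v^T = 1%:M -> u *m v^T = c%:M ->
  Eu *m Eu^T = 1%:M -> Eu *m u^T = 0 -> Ev *m Ev^T = 1%:M -> Ev *m v^T = 0 ->
  B *m B^T = 1%:M -> B *m u^T = 0 -> B *m v^T = 0 ->
  m.+2%:R / (2 * m.+1%:R) * Num.sqrt (1 - c ^+ 2) * vol K * vol [set x *m B^T | x in K] <=
  vol [set x *m Eu^T | x in K] * vol [set x *m Ev^T | x in K].
Proof.
move=> m0 cK vK uu vv uv EuEu Euu EvEv Evv BB Bu Bv.
have [sn0|s0] := leP (1 - c ^+ 2) 0.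
  by rewrite ler0_sqrtr// mulr0 !mul0r mulr_ge0// vol_ge0.
set s := Num.sqrt _; have {}s0 : 0 < s by rewrite sqrtr_gt0.
have ss : s ^+ 2 = 1 - c ^+ 2 by rewrite sqr_sqrtr// ltW// -sqrtr_gt0.
have sn0 : s != 0 by rewrite gt_eqF.
have vu : v *m u^T = c%:M by apply: trmx_inj; rewrite trmx_mul trmxK uv tr_scalar_mx.
(* Gram-Schmidt: these are the unit vectors in the plane of [u] and [v] orthogonal to [u] and to [v]
   respectively. *)
pose wu := s^-1 *: (v - c *: u); pose wv := s^-1 *: (u - c *: v).
have trE (a b : 'rV[R]_m.+2) :
    (s^-1 *: (b - c *: a))^T = s^-1 *: (b^T - c *: a^T).
  by apply/matrixP => i j; rewrite !mxE.
have orth (a b : 'rV[R]_m.+2) : a *m a^T = 1%:M -> b *m b^T = 1%:M ->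
    b *m a^T = c%:M -> a *m b^T = c%:M ->
    (s^-1 *: (b - c *: a)) *m (s^-1 *: (b - c *: a))^T = 1%:M /\
    (s^-1 *: (b - c *: a)) *m a^T = 0.
  move=> aa bb ba ab; split; last first.
    by rewrite -scalemxAl mulmxBl -scalemxAl ba aa scalemx1 subrr scaler0.
  rewrite trE -scalemxAr -scalemxAl.
  rewrite mulmxBr !mulmxBl -!scalemxAr -!scalemxAl bb ba ab aa.
  apply/matrixP => i j; rewrite !ord1 !mxE eqxx !mulr1n.
  have e : s * s = 1 - c * c by rewrite -!expr2.
  by rewrite -[RHS](divff (mulf_neq0 sn0 sn0)) {1}e; field.
have [wuwu wuu] := orth u v uu vv vu uv; have [wvwv wvv] := orth v u vv uu uv vu.
rewrite -/wu in wuwu wuu; rewrite -/wv in wvwv wvv.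
have Bw (a b : 'rV[R]_m.+2) : B *m a^T = 0 -> B *m b^T = 0 -> B *m (s^-1 *: (b - c *: a))^T = 0.
  by move=> Ba Bb; rewrite trE -scalemxAr mulmxBr -scalemxAr Ba Bb
    scaler0 subrr scaler0.
have Bwu : B *m wu^T = 0 by exact: Bw.
have Bwv : B *m wv^T = 0 by exact: Bw.
(* This relation makes the coordinate along [wv] the linear form in the coordinates along [wu] and
   [u] that [vol_fibres_le] asks for. *)
have wvE : wv = s *: u - c *: wu.
  apply/rowP => j; rewrite !mxE; apply: (mulfI sn0).
  have e : s * s = 1 - c * c by rewrite -!expr2.
  rewrite mulVKf//; transitivity ((1 - c * c) * u 0 j - c * (v 0 j - c * u 0 j)).
    by ring.
  by rewrite -e; field.
pose M := [set x *m row_mx B^T wu^T | x in K].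
pose N := [set x *m row_mx B^T wv^T | x in K].
pose K3 := [set x *m row_mx B^T (row_mx wu^T u^T) | x in K].
have vM : vol M <= vol [set x *m Eu^T | x in K] by exact: vol_projection_frame wuu BB Bu Bwu.
have vN : vol N <= vol [set x *m Ev^T | x in K] by exact: vol_projection_frame wvv BB Bv Bwv.
have vK3 : vol K <= vol K3.
  have uwu : u *m wu^T = 0 by apply: trmx_inj; rewrite trmx_mul trmxK trmx0.
  have uB : u *m B^T = 0 by apply: trmx_inj; rewrite trmx_mul trmxK trmx0.
  have wuB : wu *m B^T = 0 by apply: trmx_inj; rewrite trmx_mul trmxK trmx0.
  rewrite /K3 vol_swap_mulmx// -!tr_col_mx.
  set F := col_mx _ B.
  have wwuu : col_mx wu u *m (col_mx wu u)^T = 1%:M.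
    by rewrite tr_col_mx mul_col_row wuwu uu wuu uwu -scalar_mx_block.
  have wuuB : col_mx wu u *m B^T = 0 by rewrite mul_col_mx wuB uB col_mx0.
  have Bwuu : B *m (col_mx wu u)^T = 0.
    by apply: trmx_inj; rewrite trmx_mul trmxK trmx0.
  have FF : F *m F^T = 1%:M.
    by rewrite /F tr_col_mx mul_col_row wwuu wuuB Bwuu BB -scalar_mx_block.
  (* [K] is recovered from its coordinates [x *m F^T] by applying the orthogonal matrix [F]. *)
  apply: le_trans (vol_orthogonal (k := m.+1) FF (compact_mulmx (U := F^T) cK)).
  apply: le_vol; last exact/compact_coverable/compact_mulmx/compact_mulmx.
  move=> x Kx; exists (x *m F^T); first by exists x.
  by rewrite -mulmxA (mulmx1C FF) mulmx1.
have sh : shadow M = [set x *m B^T | x in K] by exact: shadow_mulmx.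
have := @vol_fibres_le R m K3 M N c s m0 s0 (compact_mulmx cK) (compact_mulmx cK)
  (compact_mulmx cK) (is_convex_mulmx vK) (is_convex_mulmx vK).
rewrite sh shadow_mulmx => /(_ erefl) H.
apply: le_trans (_ : _ <= m.+2%:R / (2 * m.+1%:R) * s * vol K3 * vol [set x *m B^T | x in K]) _.
  by rewrite ler_wpM2r ?vol_ge0// ler_wpM2l// mulr_ge0 ?(ltW s0)// divr_ge0// mulr_ge0.
apply: le_trans (ler_pM (vol_ge0 _) (vol_ge0 _) vM vN); apply: H => y z [x Kx].
rewrite !mul_mx_row => /(@eq_row_mx _ _ _ _)[<- <-]; rewrite row_mxKl row_mxKr; split.
  by exists x => //; rewrite mul_mx_row.
exists x => //; rewrite mul_mx_row; congr row_mx.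
have -> : wv^T = s *: u^T - c *: wu^T.
  by rewrite wvE; apply/matrixP => i j; rewrite !mxE.
rewrite mulmxBr -!scalemxAr.
by apply/rowP => i; rewrite !mxE ord1.
Qed.

Lemma coordsE n k (E : 'I_k -> 'rV[R]_n) x : coords E x = x *m (\matrix_i E i)^T.
Proof.
apply/rowP => i; rewrite !mxE /dotv; apply: eq_bigr => j _; by rewrite !mxE.
Qed.

Lemma dotvE n (x y : 'rV[R]_n) : x *m y^T = (dotv x y)%:M.
Proof.
apply/matrixP => i j; rewrite !ord1 !mxE eqxx mulr1n /dotv.
by apply: eq_bigr => k _; rewrite !mxE.
Qed.

Lemma orthonormal_familyE n k (E : 'I_k -> 'rV[R]_n) : orthonormal_family E ->
  (\matrix_i E i) *m (\matrix_i E i)^T = 1%:M.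
Proof.
move=> oE; apply/matrixP => i j; rewrite !mxE -oE /dotv.
by apply: eq_bigr => l _; rewrite !mxE.
Qed.

Lemma orthogonal_familyE n k (E : 'I_k -> 'rV[R]_n) (u : 'rV[R]_n) :
  (forall i, dotv (E i) u = 0) -> (\matrix_i E i) *m u^T = 0.
Proof.
move=> Eu; apply/matrixP => i j; rewrite ord1 !mxE -[RHS](Eu i) /dotv.
by apply: eq_bigr => l _; rewrite !mxE.
Qed.

Lemma proj_volE n k (E : 'I_k.+1 -> 'rV[R]_n) (K : set 'rV[R]_n) : compact K ->
  proj_vol E K = (vol [set x *m (\matrix_i E i)^T | x in K])%:E.
Proof.
move=> cK; rewrite /proj_vol (_ : coords E @` K = [set x *m (\matrix_i E i)^T | x in K]).
  by rewrite lebvol_compact//; exact: compact_mulmx.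
by apply: eq_imagel => x _; exact: coordsE.
Qed.

End Frames.

Theorem theorem1p4 (R : realType) (n : nat) (K : set 'rV[R]_n)
    (u v : 'rV[R]_n)
    (Eu : 'I_(n - 1) -> 'rV[R]_n) (Ev : 'I_(n - 1) -> 'rV[R]_n)
    (Euv : 'I_(n - 2) -> 'rV[R]_n) :
  (3 <= n)%N ->
  convex_body K ->
  on_sphere u -> on_sphere v ->
  (* Eu : orthonormal basis of u^perp *)
  orthonormal_family Eu -> (forall i, dotv (Eu i) u = 0) ->
  (* Ev : orthonormal basis of v^perp *)
  orthonormal_family Ev -> (forall i, dotv (Ev i) v = 0) ->
  (* Euv : orthonormal basis of (span{u,v})^perp *)
  orthonormal_family Euv -> (forall i, dotv (Euv i) u = 0) ->
  (forall i, dotv (Euv i) v = 0) ->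
  ((n%:R / (2 * (n - 1)%:R) * Num.sqrt (1 - dotv u v ^+ 2))%:E
     * lebvol K * proj_vol Euv K
   <= proj_vol Eu K * proj_vol Ev K)%E.
Proof.
(* Writing [n = m + 3], the common projection has dimension [m + 1 > 0], as required by
   [lebvol_compact] and by the roots taken in [superlevel_dominates]. *)
case: n => [|[|[|m]]] // in K u v Eu Ev Euv * => _ [cK vK _] u1 v1 oEu Euu oEv Evv oE EEu EEv.
have uu : u *m u^T = 1%:M by rewrite dotvE u1.
have vv : v *m v^T = 1%:M by rewrite dotvE v1.
have H := @local_loomis_whitney R m.+1 K u v _ _ _ _ (ltn0Sn m) cK vK uu vv (dotvE u v)
  (orthonormal_familyE oEu) (orthogonal_familyE Euu)
  (orthonormal_familyE oEv) (orthogonal_familyE Evv)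
  (orthonormal_familyE oE) (orthogonal_familyE EEu) (orthogonal_familyE EEv).
have -> : proj_vol Eu K = _ := @proj_volE R m.+3 m.+1 Eu K cK.
have -> : proj_vol Ev K = _ := @proj_volE R m.+3 m.+1 Ev K cK.
have -> : proj_vol Euv K = _ := @proj_volE R m.+3 m Euv K cK.
by rewrite lebvol_compact// -!EFinM lee_fin; exact: H.
Qed.
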